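(* Let $\Gamma$ be a finite group, $\theta:\Gamma\to O(\mathbb{R}^d)$ a point group, and let $(G,\sigma,p)$ be a $d$-dimensional tensegrity with $n$ vertices which is $\theta$-symmetric and generic modulo symmetry. Suppose also that $p(\overline{N}_G(i))$ affinely spans $\mathbb{R}^d$ for all $i\in V(G)$, where $\overline{N}_G(i)$ is the set consisting of $i$ and its neighbours in $G$. Then $(G,\sigma,p)$ is universally rigid if and only if it has a strictly proper equilibrium stress $\omega$ satisfying $L_{G,\omega}\succeq 0$ and $\operatorname{rank} L_{G,\omega}=n-d-1$.
   Context: Tensegrities: a $d$-dimensional tensegrity is a triple $(G,\sigma,p)$ with $G=(V,E)$ a finite simple graph, $\sigma:E\to\{-1,0,+1\}$, $p:V\to\mathbb{R}^d$; $E_0,E_+,E_-$ are the edges with sign $0,+1,-1$. $(G,\sigma,p)$ dominates $(G,\sigma,q)$ ($q:V\to\mathbb{R}^{d'}$) if $\|p_i-p_j\|\geq\|q_i-q_j\|$ on $E_+$, $=$ on $E_0$, $\leq$ on $E_-$; $p,q$ are congruent if $\|p_i-p_j\|=\|q_i-q_j\|$ for all $i,j\in V$. $(G,\sigma,p)$ is universally rigid if for every $d'\geq d$ (with $\mathbb{R}^d\subseteq\mathbb{R}^{d'}$) every $q:V\to\mathbb{R}^{d'}$ dominated by it is congruent to $p$. For $\omega:E\to\mathbb{R}$, $L_{G,\omega}=\sum_{ij\in E}\omega_{ij}(\mathbf{e}_i-\mathbf{e}_j)(\mathbf{e}_i-\mathbf{e}_j)^\top$; $\omega$ is an equilibrium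 stress if $\sum_{j\in N_G(i)}\omega_{ij}(p_i-p_j)=\mathbf{0}$ for all $i$; strictly proper if $\sigma(ij)\omega_{ij}\geq0$ for all edges with strict inequality for all edges in $E_+\cup E_-$. Symmetry: a $\Gamma$-gain graph on a finite set $\hat V$ is a set $\hat E$ of triples $(u,v,\gamma)\in\hat V\times\hat V\times\Gamma$ considered up to the identification $(u,v,\gamma)\sim(v,u,\gamma^{-1})$. Its lift is the undirected graph on $\Gamma\times\hat V$ in which $\{(\alpha,u),(\beta,v)\}$ is an edge iff $(u,v,\alpha^{-1}\beta)\in\hat E$. A point group is a homomorphism $\theta:\Gamma\to O(\mathbb{R}^d)$. A configuration $p:\Gamma\times\hat V\to\mathbb{R}^d$ is compatible with $\theta$ if $\theta(\gamma)p_{(\alpha,v)}=p_{(\gamma\alpha,v)}$ for all $\gamma,\alpha\in\Gamma$, $v\in\hat V$. $\mathcal{C}_\theta(V)$ is the set of configurations $V=\Gamma\times\hat V\to\mathbb{R}^d$ compatible with $\theta$ with $\sum_{i\in V}p_i=\mathbf{0}$. A tensegrity $(G,\sigma,p)$ with $V(G)=\Gamma\times\hat V$ is $\theta$-symmetric if each of $(V,E_0),(V,E_+),(V,E_-)$ is the lift of some $\Gamma$-gain graph on $\hat V$ and $p$ is compatible with $\theta$. Fix, for each equivalence class of real irreducible representations of $\Gamma$, a representative orthogonal matrix representation; let $\mathbb{Q}_{\theta,\Gamma}$ be the field generated over $\mathbb{Q}$ by the entries of all $\theta(\gamma)$ and of these representative matrices. For a semi-algebraic set $S$ defined over a field $K$,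 a point $x\in S$ is generic in $S$ (over $K$) if there is no polynomial $f$ with coefficients in $K$ with $f(x)=0$ and $f(y)\neq0$ for some $y\in S$. $(G,\sigma,p)$ is generic modulo symmetry if the translate of $p$ whose centroid is the origin is generic over $\mathbb{Q}_{\theta,\Gamma}$ in $\mathcal{C}_\theta(V)$. *)

(* Defs.v *)
From HB Require Import structures.
From mathcomp Require Import all_boot all_order all_algebra all_fingroup.
From mathcomp Require Import mxrepresentation.
From mathcomp Require Import reals.
From mathcomp Require Import mpoly.

Set Implicit Arguments.
Unset Strict Implicit.
Unset Printing Implicit Defensive.

Import Order.TTheory GRing.Theory Num.Theory.
Local Open Scope ring_scope.

Section Tensegrity.
Variable R : realType.

Definition edist k (x y : 'cV[R]_k) : R :=
  Num.sqrt (\sum_(a < k) (x a 0 - y a 0) ^+ 2).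

Variable V : finType.

Definition simple_graph (G : rel V) :=
  (forall i, ~~ G i i) /\ (forall i j, G i j = G j i).

Definition sign_map (G : rel V) (sigma : V -> V -> int) :=
  forall i j, G i j -> sigma i j = sigma j i /\ sigma i j \in [:: -1; 0; 1].

Definition tensegrity (G : rel V) (sigma : V -> V -> int) :=
  simple_graph G /\ sign_map G sigma.

Definition E0 (G : rel V) (sigma : V -> V -> int) : rel V :=
  fun i j => G i j && (sigma i j == 0).
Definition Eplus (G : rel V) (sigma : V -> V -> int) : rel V :=
  fun i j => G i j && (sigma i j == 1).
Definition Eminus (G : rel V) (sigma : V -> V -> int) : rel V :=
  fun i j => G i j && (sigma i j == -1).

Definition dominates (G : rel V) (sigma : V -> V -> int) d d'
    (p : V -> 'cV[R]_d) (q : V -> 'cV[R]_d') :=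
  forall i j,
    (Eplus G sigma i j -> edist (p i) (p j) >= edist (q i) (q j)) /\
    (E0 G sigma i j -> edist (p i) (p j) = edist (q i) (q j)) /\
    (Eminus G sigma i j -> edist (p i) (p j) <= edist (q i) (q j)).

Definition congruent d d' (p : V -> 'cV[R]_d) (q : V -> 'cV[R]_d') :=
  forall i j, edist (p i) (p j) = edist (q i) (q j).

(* Universal rigidity (R^d is seen inside R^d'; only distances matter). *)
Definition universally_rigid (G : rel V) (sigma : V -> V -> int) d
    (p : V -> 'cV[R]_d) :=
  forall d', (d <= d')%N -> forall q : V -> 'cV[R]_d',
    dominates G sigma p q -> congruent p q.

Definition evec (i : V) : 'cV[R]_#|{: V}| := delta_mx (enum_rank i) 0.

Definition stress_on (G : rel V) (omega : V -> V -> R) :=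
  forall i j, G i j -> omega i j = omega j i.

(* L_{G,omega} = sum over (unordered) edges ij of
   omega_ij (e_i - e_j)(e_i - e_j)^T; each unordered edge is counted twice
   in the sum over ordered pairs, hence the factor 1/2. *)
Definition laplacian (G : rel V) (omega : V -> V -> R) : 'M[R]_#|{: V}| :=
  2^-1 *: \sum_(e : V * V | G e.1 e.2)
     omega e.1 e.2 *: ((evec e.1 - evec e.2) *m (evec e.1 - evec e.2)^T).

Definition equilibrium_stress (G : rel V) (omega : V -> V -> R) d
    (p : V -> 'cV[R]_d) :=
  forall i, \sum_(j | G i j) omega i j *: (p i - p j) = 0.

Definition strictly_proper (G : rel V) (sigma : V -> V -> int)
    (omega : V -> V -> R) :=
  forall i j, G i j ->
    0 <= (sigma i j)%:~R * omega i j /\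
    (sigma i j != 0 -> 0 < (sigma i j)%:~R * omega i j).

Definition psd n (L : 'M[R]_n) := forall x : 'cV[R]_n, 0 <= (x^T *m L *m x) 0 0.

Definition closed_nbhd (G : rel V) (i : V) : pred V := fun j => (j == i) || G i j.

Definition affinely_spans d (A : pred V) (p : V -> 'cV[R]_d) :=
  forall x : 'cV[R]_d, exists lam : V -> R,
    (forall j, ~~ A j -> lam j = 0) /\ \sum_j lam j = 1 /\
    \sum_j lam j *: p j = x.

Definition coords d (p : V -> 'cV[R]_d) : 'I_#|{: V * 'I_d}| -> R :=
  fun k => p (enum_val k).1 (enum_val k).2 0.

Definition centered d (p : V -> 'cV[R]_d) : V -> 'cV[R]_d :=
  fun i => p i - (#|{: V}|%:R)^-1 *: \sum_j p j.

Definition generic_in d (K : R -> Prop) (S : (V -> 'cV[R]_d) -> Prop)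
    (p : V -> 'cV[R]_d) :=
  S p /\
  ~ exists f : {mpoly R[#|{: V * 'I_d}|]},
      (forall m, K (mcoeff m f)) /\ f.@[coords p] = 0 /\
      exists q, S q /\ f.@[coords q] != 0.

End Tensegrity.

Definition gen_field (R : fieldType) (S : R -> Prop) (x : R) : Prop :=
  forall P : R -> Prop,
    (forall y, S y -> P y) -> P 1 ->
    (forall a b, P a -> P b -> P (a - b)) ->
    (forall a b, P a -> P b -> P (a * b)) ->
    (forall a, P a -> P a^-1) -> P x.

Section Symmetry.
Variable R : realType.
Variables (gT : finGroupType) (hV : finType).

Local Notation V := (gT * hV)%type.

Definition orthogonal_mx n (M : 'M[R]_n) := M *m M^T = 1%:M.

Definition point_group d (theta : mx_representation R [set: gT]%G d) :=
  forall g, orthogonal_mx (theta g).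

(* A Gamma-gain graph on hV is a set of triples (u,v,gamma); its lift. *)
Definition lift (Eh : {set hV * hV * gT}) : rel V :=
  fun x y => ((x.2, y.2, (x.1^-1 * y.1)%g) \in Eh) || ((y.2, x.2, (y.1^-1 * x.1)%g) \in Eh).

Definition compatible d (theta : mx_representation R [set: gT]%G d)
    (p : V -> 'cV[R]_d) :=
  forall (g a : gT) (v : hV), theta g *m p (a, v) = p ((g * a)%g, v).

Definition C_theta d (theta : mx_representation R [set: gT]%G d)
    (p : V -> 'cV[R]_d) :=
  compatible theta p /\ \sum_i p i = 0.

Definition theta_symmetric d (theta : mx_representation R [set: gT]%G d)
    (G : rel V) (sigma : V -> V -> int) (p : V -> 'cV[R]_d) :=
  (exists Eh : {set hV * hV * gT}, lift Eh =2 E0 G sigma) /\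
  (exists Eh : {set hV * hV * gT}, lift Eh =2 Eplus G sigma) /\
  (exists Eh : {set hV * hV * gT}, lift Eh =2 Eminus G sigma) /\
  compatible theta p.

Definition irrep_representatives k (deg : 'I_k -> nat)
    (rho : forall r : 'I_k, mx_representation R [set: gT]%G (deg r)) :=
  (forall r, mx_irreducible (rho r)) /\
  (forall r g, orthogonal_mx (rho r g)) /\
  (forall r s, mx_rsim (rho r) (rho s) -> r = s) /\
  (forall n (rG : mx_representation R [set: gT]%G n),
      mx_irreducible rG -> exists r, mx_rsim rG (rho r)).

Definition Q_theta_Gamma d (theta : mx_representation R [set: gT]%G d)
    k (deg : 'I_k -> nat)
    (rho : forall r : 'I_k, mx_representation R [set: gT]%G (deg r)) : R -> Prop :=
  gen_field (fun y => (exists g i j, y = theta g i j) \/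
                      (exists r g i j, y = rho r g i j)).

Definition generic_mod_symmetry d (theta : mx_representation R [set: gT]%G d)
    k (deg : 'I_k -> nat)
    (rho : forall r : 'I_k, mx_representation R [set: gT]%G (deg r))
    (p : V -> 'cV[R]_d) :=
  generic_in (Q_theta_Gamma theta rho) (C_theta theta) (centered p).

End Symmetry.

(* Main.v *)
Require Import Defs.
From HB Require Import structures.
From mathcomp Require Import all_boot all_order all_algebra all_fingroup.
From mathcomp Require Import mxrepresentation.
From mathcomp Require Import boolp classical_sets reals topology normedtype.
From mathcomp Require Import polyorder polyrcf.
From mathcomp Require Import ring lra.
From mathcomp Require mpoly.
Set Implicit Arguments.
Unset Strict Implicit.
Unset Printing Implicit Defensive.
Import Order.TTheory GRing.Theory Num.Theory.
Local Open Scope ring_scope.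

(** For sufficiency, the stress energy forces every dominated [q] to be an
    affine image of [p] with the same edge lengths, and the equilibrium and
    spanning conditions rule out nontrivial affine motions.

    For necessity, convex duality at [p] yields either the required stress or a
    "flex": a velocity [v] whose first-order change of squared edge lengths is
    minus that of a second-order term, given by a positive semidefinite matrix
    [u u^T] orthogonal to [1] and [p] plus signed slacks [r ^ 2] on cables and
    struts.  Summing over the group makes [v] symmetric.  A flex is a solution of
    polynomial equations with coefficients in [K := Q_theta_Gamma], so, [p] being
    generic over [K], the solution extends to all symmetric configurations
    near [p].  Following the resulting velocities from [p] by Euler's scheme and
    passing to the limit gives [q] near [p] and an integrated Gram matrix [Y]
    such that [q] plus a realisation of [Y] in extra dimensions is dominated by
    [p] but not congruent to it. *)

(** * Polynomial functions *)

(** Genericity only says that a polynomial over [K] vanishing at [p] vanishes on all of [C_theta],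
    whereas having a flex is an existential condition; its unknowns are therefore eliminated one at
    a time. This is why every condition to be lifted is an equation, with [u u^T] standing for a
    semidefinite matrix and [r ^ 2] for a nonnegative slack. The velocity found at a nearby
    configuration need not depend continuously on it, so existence theorems for differential
    equations do not apply; Euler's scheme needs only uniform bounds. Non-congruence of the limit is
    detected by a weight [w] orthogonal to [1] and [p]: the sum of [w_i w_j] times squared distances
    is zero for [p] and at most [-2 w^T Y w] for the limit. Congruence would thus give
    [w^T Y w <= 0] and make all slacks vanish, while the sum of [w^T Y w] and the slacks grows at a
    rate bounded below along the scheme. *)

Section PolynomialFunctions.
Variables (R : rcfType) (K : R -> Prop) (I : finType).

Local Notation fn := ((I -> R) -> (nat -> R) -> R).

(** Polynomials are represented by the functions they define, so that closure and continuity are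
    inductions. The base point [x] will be a configuration and [y] lists the unknowns, of which only
    the first [N] may occur. *)
Inductive polyfun (N : nat) : fn -> Prop :=
| polyfun_cst c : K c -> polyfun N (fun _ _ => c)
| polyfun_base i : polyfun N (fun x _ => x i)
| polyfun_var n : (n < N)%N -> polyfun N (fun _ y => y n)
| polyfun_add f g : polyfun N f -> polyfun N g ->
    polyfun N (fun x y => f x y + g x y)
| polyfun_mul f g : polyfun N f -> polyfun N g ->
    polyfun N (fun x y => f x y * g x y).

Lemma polyfun_eq_var N f (x : I -> R) (y y' : nat -> R) : polyfun N f ->
  (forall n, (n < N)%N -> y n = y' n) -> f x y = f x y'.
Proof.
by move=> Pf yy'; elim: Pf => //= [g h _ -> _ ->|g h _ -> _ ->].
Qed.

Lemma polyfun_ext N (f g : fn) : (forall x y, g x y = f x y) ->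
  polyfun N f -> polyfun N g.
Proof. by move=> fg; rewrite (_ : g = f)//; apply/funext => x; apply/funext. Qed.

Hypotheses (K1 : K 1) (KB : forall a b, K a -> K b -> K (a - b)).

Lemma subring_0 : K 0. Proof. by rewrite -(subrr 1); apply: KB. Qed.
Lemma subring_N a : K a -> K (- a).
Proof. by move=> Ka; rewrite -sub0r; apply: KB => //; apply: subring_0. Qed.
Lemma subring_D a b : K a -> K b -> K (a + b).
Proof. by move=> Ka Kb; rewrite -[b]opprK; apply: KB => //; apply: subring_N. Qed.

Lemma polyfun_opp N f : polyfun N f -> polyfun N (fun x y => - f x y).
Proof.
move=> Pf; apply: (polyfun_ext (fun x y => esym (mulN1r (f x y)))).
by apply: polyfun_mul => //; apply/polyfun_cst/subring_N.
Qed.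

Lemma polyfun_sub N f g : polyfun N f -> polyfun N g ->
  polyfun N (fun x y => f x y - g x y).
Proof. by move=> Pf Pg; apply: polyfun_add => //; apply: polyfun_opp. Qed.

Lemma polyfun_exp N f n : polyfun N f -> polyfun N (fun x y => f x y ^+ n).
Proof.
move=> Pf; elim: n => [|n IHn]; first exact: polyfun_cst.
apply: (polyfun_ext (fun x y => exprS _ _)).
exact: polyfun_mul.
Qed.

Lemma polyfun_sum N (J : Type) (s : seq J) (P : pred J) (F : J -> fn) :
  (forall j, polyfun N (F j)) ->
  polyfun N (fun x y => \sum_(j <- s | P j) F j x y).
Proof.
move=> PF; elim: s => [|j s IHs].
  apply: (polyfun_ext (fun x y => big_nil _ _ _ _)).
  exact/polyfun_cst/subring_0.
apply: (polyfun_ext (fun x y => big_cons _ _ _ _ _ _)).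
by case: (P j) => //; apply: polyfun_add.
Qed.

(* Univariate polynomials over the ring of polynomial functions in the first
   [N] variables. *)
Definition polyfam N k (P : (I -> R) -> (nat -> R) -> {poly R}) :=
  (forall x y, (size (P x y) <= k)%N) /\
  (forall i, polyfun N (fun x y => (P x y)`_i)).

Lemma polyfam_widen N k l P : (k <= l)%N -> polyfam N k P -> polyfam N l P.
Proof. by move=> kl [sP cP]; split=> // x y; apply: leq_trans kl. Qed.

Lemma polyfam_add N k P Q : polyfam N k P -> polyfam N k Q ->
  polyfam N k (fun x y => P x y + Q x y).
Proof.
move=> [sP cP] [sQ cQ]; split=> [x y|i].
  by rewrite (leq_trans (size_polyD _ _))// geq_max sP sQ.
apply: (polyfun_ext (fun x y => coefD _ _ _)).
exact: polyfun_add.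
Qed.

Lemma polyfam_mul N k l P Q : polyfam N k P -> polyfam N l Q ->
  polyfam N (k + l) (fun x y => P x y * Q x y).
Proof.
move=> [sP cP] [sQ cQ]; split=> [x y|i].
  rewrite (leq_trans (size_polyMleq _ _))// (leq_trans (leq_pred _))//.
  exact: leq_add.
apply: (polyfun_ext (fun x y => coefM _ _ _)).
by apply: polyfun_sum => j; apply: polyfun_mul.
Qed.

Lemma polyfam_polyC N f : polyfun N f -> polyfam N 1 (fun x y => (f x y)%:P).
Proof.
move=> Pf; split=> [x y|i]; first exact: size_polyC_leq1.
apply: (polyfun_ext (fun x y => coefC _ _)).
by case: (i == 0)%N => //; apply/polyfun_cst/subring_0.
Qed.

Lemma polyfam_X N : polyfam N 2 (fun _ _ => 'X).
Proof.
split=> [x y|i]; first by rewrite size_polyX.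
apply: (polyfun_ext (fun x y => coefX _ _)).
by apply: polyfun_cst; case: (i == 1)%N => //=; apply: subring_0.
Qed.

(** The last unknown becomes the indeterminate. The size bound is uniform in the point, so that
    conditions on all coefficients are finite conjunctions. *)
Lemma polyfun_polyfam N f : polyfun N.+1 f ->
  exists k P, polyfam N k P /\ forall x y, f x y = (P x y).[y N].
Proof.
elim=> {f} [c Kc|i|n nN|f g _ [k [P [fP eP]]] _ [l [Q [fQ eQ]]]
    |f g _ [k [P [fP eP]]] _ [l [Q [fQ eQ]]]].
- exists 1%N, (fun _ _ => c%:P); split; last by move=> x y; rewrite hornerC.
  by apply: (@polyfam_polyC _ (fun _ _ => c)); apply: polyfun_cst.
- exists 1%N, (fun x _ => (x i)%:P); split; last by move=> x y; rewrite hornerC.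
  by apply: (@polyfam_polyC _ (fun x _ => x i)); apply: polyfun_base.
- have [->|nN'] := eqVneq n N.
    exists 2%N, (fun _ _ => 'X); split; last by move=> x y; rewrite hornerX.
    exact: polyfam_X.
  exists 1%N, (fun _ y => (y n)%:P); split; last by move=> x y; rewrite hornerC.
  apply: (@polyfam_polyC _ (fun _ y => y n)); apply: polyfun_var.
  by move: nN; rewrite ltnS leq_eqVlt (negPf nN').
- exists (maxn k l), (fun x y => P x y + Q x y); split.
    apply: polyfam_add; first by apply: polyfam_widen fP; rewrite leq_maxl.
    by apply: polyfam_widen fQ; rewrite leq_maxr.
  by move=> x y; rewrite hornerD eP eQ.
- exists (k + l)%N, (fun x y => P x y * Q x y); split; first exact: polyfam_mul.
  by move=> x y; rewrite hornerM eP eQ.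
Qed.

(* Pseudo-division by [Q], whose coefficient of degree [k] plays the role of
   the leading coefficient; only the value at a root of [Q] matters. *)
Lemma polyfam_pseudo_div N k Q l P : (0 < k)%N -> polyfam N k.+1 Q ->
  polyfam N l P -> exists m S, polyfam N k S /\
    forall x y t, (Q x y).[t] = 0 ->
      (Q x y)`_k ^+ m * (P x y).[t] = (S x y).[t].
Proof.
move=> k0 [sQ cQ] fP.
have fC0 f : polyfun N f -> polyfam N k (fun x y => (f x y)%:P).
  by move=> Pf; apply: polyfam_widen (polyfam_polyC Pf).
elim: l P fP => [|l IHl] P [sP cP].
  exists 0%N, (fun _ _ => 0); split.
    by apply: (fC0 (fun _ _ => 0)); apply/polyfun_cst/subring_0.
  move=> x y t _; have := sP x y; rewrite leqn0 size_poly_eq0 => /eqP ->.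
  by rewrite horner0 mulr0.
(* Horner's rule: [P] is its constant term plus [X] times the shorter [P1]. *)
pose P1 x y : {poly R} := \poly_(i < l) (P x y)`_i.+1.
have fP1 : polyfam N l P1.
  split=> [x y|i]; first exact: size_poly.
  apply: (polyfun_ext (fun x y => coef_poly _ _ _)).
  by case: (i < l)%N => //; apply/polyfun_cst/subring_0.
have PE x y t : (P x y).[t] = (P x y)`_0 + t * (P1 x y).[t].
  rewrite [in LHS](_ : P x y = ((P x y)`_0)%:P + 'X * P1 x y).
    by rewrite hornerD hornerC hornerM hornerX.
  apply/polyP => -[|i]; rewrite coefD coefC coefXM ?addr0//= add0r coef_poly.
  by case: ltnP => // li; apply: nth_default; rewrite (leq_trans (sP x y)).
have [m [S [[sS cS] ES]]] := IHl P1 fP1.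
(* [X S] may reach degree [k]; in [Q_k X S - S_(k-1) Q] the terms of degree [k] cancel. *)
pose S' x y : {poly R} := \poly_(i < k)
  ((Q x y)`_k * (if i is j.+1 then (S x y)`_j else 0) -
   (S x y)`_k.-1 * (Q x y)`_i).
exists m.+1, (fun x y => ((Q x y)`_k ^+ m.+1 * (P x y)`_0)%:P + S' x y); split.
  apply: polyfam_add.
    by apply: (fC0 (fun x y => _ * _)); apply: polyfun_mul => //; apply: polyfun_exp.
  split=> [x y|i]; first exact: size_poly.
  apply: (polyfun_ext (fun x y => coef_poly _ _ _)).
  case: (i < k)%N; last exact/polyfun_cst/subring_0.
  apply: polyfun_sub; apply: polyfun_mul => //.
  by case: i => // ; apply/polyfun_cst/subring_0.
move=> x y t Q0; rewrite PE mulrDr hornerD hornerC; congr (_ + _).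
have SE : (S x y).[t] = \sum_(i < k) (S x y)`_i * t ^+ i.
  by rewrite (horner_coef_wide _ (sS x y)).
have QE : (Q x y)`_k * t ^+ k = - \sum_(i < k) (Q x y)`_i * t ^+ i.
  have := Q0; rewrite (horner_coef_wide _ (sQ x y)) big_ord_recr/= addrC.
  by move/eqP; rewrite addr_eq0 => /eqP.
rewrite exprS -mulrA (mulrCA _ t) ES// SE horner_poly.
under [RHS]eq_bigr do rewrite mulrBl -!mulrA.
rewrite sumrB -!mulr_sumr -[X in _ - _ * X]opprK -QE mulrN opprK.
case: k k0 {fC0 IHl S' sQ cQ sS cS ES QE} SE => //= k _ SE.
rewrite [in RHS]big_ord_recl/= mul0r add0r [in LHS]big_ord_recr/=.
under [in RHS]eq_bigr do rewrite add0n /bump/= add1n exprS mulrCA.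
by rewrite -mulr_sumr exprS; ring.
Qed.

Lemma mul_near (a b e : R) : 0 < e -> exists2 h, 0 < h &
  forall a' b', `|a' - a| < h -> `|b' - b| < h -> `|a' * b' - a * b| < e.
Proof.
move=> e0; pose D := `|a| + `|b| + 1.
have D1 : 1 <= D by rewrite lerDr addr_ge0.
have D0 : 0 < D by apply: lt_le_trans D1.
exists (Num.min 1 (e / D)); first by rewrite lt_min ltr01 divr_gt0.
move=> a' b'; rewrite !lt_min => /andP[a1 ae] /andP[b1 be].
rewrite (_ : _ - _ = (a' - a) * (b' - b) + a * (b' - b) + (a' - a) * b); last by ring.
apply: le_lt_trans (ler_normD _ _) _; rewrite normrM.
apply: le_lt_trans (lerD (ler_normD _ _) (lexx _)) _; rewrite !normrM.
have aD : `|a' - a| * D < e by rewrite -ltr_pdivlMr.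
have bD : `|b' - b| * D < e by rewrite -ltr_pdivlMr.
(* The larger increment times [D] bounds all three terms, the other increment being below 1 in the
   quadratic one. *)
have [ab|ba] := leP `|a' - a| `|b' - b|.
  apply: le_lt_trans bD; rewrite /D !mulrDr mulr1.
  have := ler_wpM2r (normr_ge0 b) ab.
  have := ler_wpM2l (normr_ge0 (b' - b)) (ltW a1).
  by nra.
apply: le_lt_trans aD; rewrite /D !mulrDr mulr1.
have := ler_wpM2r (normr_ge0 a) (ltW ba).
have := ler_wpM2l (normr_ge0 (a' - a)) (ltW b1).
by nra.
Qed.

Lemma polyfun_continuous N f (x : I -> R) (y : nat -> R) (e : R) :
  polyfun N f -> 0 < e -> exists2 h, 0 < h & forall x' y',
    (forall i, `|x' i - x i| < h) ->
    (forall n, (n < N)%N -> `|y' n - y n| < h) -> `|f x' y' - f x y| < e.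
Proof.
move=> Pf; elim: Pf e => {f} [c _|i|n nN|f g _ IHf _ IHg|f g _ IHf _ IHg] e e0.
- by exists 1 => // x' y' _ _; rewrite subrr normr0.
- by exists e.
- by exists e => // x' y' _; apply.
- have e20 : 0 < e / 2 by rewrite divr_gt0.
  have [hf hf0 cf] := IHf _ e20; have [hg hg0 cg] := IHg _ e20.
  exists (Num.min hf hg); first by rewrite lt_min hf0 hg0.
  move=> x' y' xx yy; rewrite opprD addrACA.
  apply: le_lt_trans (ler_normD _ _) _; rewrite [e]splitr; apply: ltrD.
    by apply: cf => [i|n /yy]; [have := xx i|]; rewrite lt_min => /andP[].
  by apply: cg => [i|n /yy]; [have := xx i|]; rewrite lt_min => /andP[].
have [h h0 cm] := mul_near (f x y) (g x y) e0.
have [hf hf0 cf] := IHf _ h0; have [hg hg0 cg] := IHg _ h0.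
exists (Num.min hf hg); first by rewrite lt_min hf0 hg0.
move=> x' y' xx yy; apply: cm.
  by apply: cf => [i|n /yy]; [have := xx i|]; rewrite lt_min => /andP[].
by apply: cg => [i|n /yy]; [have := xx i|]; rewrite lt_min => /andP[].
Qed.

End PolynomialFunctions.

(** * Following a real solution of polynomial equations near a generic point *)

Section Lifting.
Variables (R : rcfType) (I : finType).

Local Notation fn := ((I -> R) -> (nat -> R) -> R).
Local Notation pfam := ((I -> R) -> (nat -> R) -> {poly R}).

Lemma polyfun_mono (K K' : R -> Prop) N (f : fn) : (forall a, K a -> K' a) ->
  polyfun K N f -> polyfun K' N f.
Proof.
move=> KK'; elim=> {f} [c /KK' Kc|i|n nN|f g _ Pf _ Pg|f g _ Pf _ Pg].
- exact: polyfun_cst.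
- exact: polyfun_base.
- exact: polyfun_var.
- exact: polyfun_add.
- exact: polyfun_mul.
Qed.

(** The evaluation point [t] may lie outside [K], hence the passage to all real constants. *)
Lemma polyfam_horner_continuous (K : R -> Prop) N k P (x : I -> R)
    (y : nat -> R) t e : polyfam K N k P -> 0 < e ->
  exists2 h, 0 < h & forall x' y', (forall i, `|x' i - x i| < h) ->
    (forall n, (n < N)%N -> `|y' n - y n| < h) ->
    `|(P x' y').[t] - (P x y).[t]| < e.
Proof.
move=> [sP cP]; apply: (@polyfun_continuous _ (fun _ => True)).
apply: (polyfun_ext (fun x y => horner_coef_wide _ (sP x y))).
apply: polyfun_sum => // i; apply: polyfun_mul; last exact: polyfun_cst.
exact: polyfun_mono (cP i).
Qed.

(** Write [p = q (X - t)]: the derivative at [t] is [q(t)], so [q] keeps its sign near [t] while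
    [X - t] changes sign. *)
Lemma simple_root_sign_change (p : {poly R}) (t e : R) : 0 < e ->
  p.[t] = 0 -> p^`().[t] != 0 -> exists t1 t2,
    [/\ `|t1 - t| < e, `|t2 - t| < e, t1 <= t2 & p.[t1] * p.[t2] < 0].
Proof.
move=> e0 pt0; have /factor_theorem[q pE] : root p t by apply/eqP.
rewrite {}pE derivM !hornerE subrr mulr0 add0r derivXsubC hornerC mulr1 => qt.
have q0 : 0 < `|q.[t]| by rewrite normr_gt0.
have [h h0 hq] := poly_cont t q q0.
pose m := Num.min (e / 2) (h / 2).
have m0 : 0 < m by rewrite lt_min !divr_gt0.
have me : m < e by rewrite gt_min ltr_pdivrMr// mulr2n mulrDr mulr1 ltrDl e0.
have mh : m < h by rewrite gt_min [X in _ || X]ltr_pdivrMr// mulrDr mulr1 ltrDl h0 orbT.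
exists (t - m), (t + m).
have E1 : `|t - m - t| = m by rewrite addrAC subrr add0r normrN gtr0_norm.
have E2 : `|t + m - t| = m by rewrite addrAC subrr add0r gtr0_norm.
have q1 := hq (t - m); have q2 := hq (t + m).
rewrite E1 E2 in q1 q2 *; split=> //; first by rewrite lerD2l; lra.
move/(_ mh) : q1; move/(_ mh) : q2.
rewrite !hornerM !hornerXsubC; move: q.[t - m] q.[t + m] q.[t] qt {hq q0} => a b c c0 bc ac.
have mm : 0 < m * m by rewrite mulr_gt0.
have : 0 < a * b.
  have [cp|cn|c00] := ltgtP c 0; last by rewrite c00 eqxx in c0.
  - rewrite (ltr0_norm cp) !ltr_distl in ac bc *.
    by rewrite nmulr_rgt0; lra.
  - rewrite (gtr0_norm cn) !ltr_distl in ac bc *.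
    by rewrite mulr_gt0; lra.
by move=> ab; nra.
Qed.

Variables (K : R -> Prop) (C : (I -> R) -> Prop).
Hypotheses (K1 : K 1) (KB : forall a b, K a -> K b -> K (a - b)).

(** One equation stands for a whole system, through sums of squares over a real field. *)
Definition liftable N (x : I -> R) (y : nat -> R) :=
  forall f : fn, polyfun K N f -> f x y = 0 -> forall e, 0 < e ->
  exists2 h, 0 < h & forall x', C x' -> (forall i, `|x' i - x i| < h) ->
    exists2 y', f x' y' = 0 & forall n, (n < N)%N -> `|y' n - y n| < e.

Let upd N (y : nat -> R) t : nat -> R := fun n => if n == N then t else y n.

Let upd_small N y t n : (n < N)%N -> upd N y t n = y n.
Proof. by move=> nN; rewrite /upd ltn_eqF. Qed.

Let updN N y t : upd N y t N = t. Proof. by rewrite /upd eqxx. Qed.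

Let polyfam_upd N k (P : pfam) x y t : polyfam K N k P -> P x (upd N y t) = P x y.
Proof.
move=> [_ cP]; apply/polyP => i; apply: (polyfun_eq_var _ (cP i)) => n.
exact: upd_small.
Qed.

Lemma polyfam_eq0P N k (P : pfam) x y : polyfam K N k P ->
  reflect (P x y = 0) (\sum_(i < k) (P x y)`_i ^+ 2 == 0).
Proof.
move=> [sP _]; rewrite psumr_eq0; last by move=> i _; rewrite sqr_ge0.
apply: (iffP allP) => [P0|-> i _]; last by rewrite /= coef0 expr0n.
apply/polyP => i; rewrite coef0; have [ik|ki] := ltnP i k.
  by have := P0 (Ordinal ik) (mem_index_enum _); rewrite /= sqrf_eq0 => /eqP.
by apply: nth_default; rewrite (leq_trans (sP x y)).
Qed.

(** The coefficients are kept zero simultaneously, by lifting the single equation that their squares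
    sum to zero. *)
Lemma liftable_vanishing N k (P : pfam) x y : polyfam K N k P -> P x y = 0 ->
  liftable N x y -> forall e, 0 < e ->
  exists2 h, 0 < h & forall x', C x' -> (forall i, `|x' i - x i| < h) ->
    exists2 y', P x' y' = 0 & forall n, (n < N)%N -> `|y' n - y n| < e.
Proof.
move=> fP Pz lz e e0.
have Pf : polyfun K N (fun x y => \sum_(i < k) (P x y)`_i ^+ 2).
  by apply: polyfun_sum => // i; apply: polyfun_exp => //; apply: fP.2.
have [|h h0 H] := lz _ Pf _ _ e0; first exact/eqP/(polyfam_eq0P _ _ fP).
exists h => // x' Cx' xx'; have [y' /eqP/(polyfam_eq0P _ _ fP) P0 yy'] := H x' Cx' xx'.
by exists y'.
Qed.

(* If [y N] is transcendental over the previous coordinates it can be kept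
   constant.  Otherwise it is a simple root of a polynomial of minimal degree, so
   it persists nearby by the intermediate value theorem, and pseudo-division by
   that polynomial transfers the remaining equations. *)
Lemma liftableS N x y : liftable N x y -> liftable N.+1 x y.
Proof.
move=> lz f /(polyfun_polyfam K1 KB)[k [P [fP fE]]] f0 e e0.
have [[l [Q [fQ Q0 Qy]]]|nQ] := pselect (exists l (Q : pfam),
    [/\ polyfam K N l Q, Q x y != 0 & (Q x y).[y N] = 0]); last first.
  have P0 : P x y = 0.
    by apply/eqP/negPn/negP => P0; apply: nQ; exists k, P; split=> //; rewrite -fE.
  have [h h0 H] := liftable_vanishing fP P0 lz e0.
  exists h => // x' Cx' xx'; have [y' P'0 yy'] := H x' Cx' xx'.
  exists (upd N y' (y N)); first by rewrite fE updN (polyfam_upd _ _ _ fP) P'0 horner0.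
  move=> n; rewrite ltnS leq_eqVlt => /predU1P[->|nN].
    by rewrite updN subrr normr0.
  by rewrite upd_small// yy'.
pose root_size s := exists l (Q : pfam), [/\ polyfam K N l Q, Q x y != 0,
  (Q x y).[y N] = 0 & size (Q x y) = s].
have exs : exists s, `[< root_size s >].
  by exists (size (Q x y)); apply/asboolP; exists l, Q.
have [s /asboolP[{}l [{}Q [{}fQ {}Q0 {}Qy sQ]]] smin] := ex_minnP exs.
have [d ds d0] : exists2 d, s = d.+1 & (0 < d)%N.
  case: s sQ {smin} => [|[|d]] sQ; last by exists d.+1.
    by move/eqP : sQ Q0; rewrite size_poly_eq0 => ->.
  have /size_poly1P[c c0 Qc] : size (Q x y) == 1%N by rewrite sQ.
  by move: Qy c0; rewrite Qc hornerC => ->; rewrite eqxx.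
have {exs}dmin m S : polyfam K N m S -> (S x y).[y N] = 0 ->
    (size (S x y) <= d)%N -> S x y = 0.
  move=> fS Sy Sd; apply/eqP/negPn/negP => S0.
  suff: (s <= size (S x y))%N by rewrite ds ltnNge Sd.
  by apply: smin; apply/asboolP; exists m, S.
(* The family may have higher degree elsewhere than at the point. Truncation makes the coefficient
   of degree [d], nonzero at the point and hence nearby, the formal leading one. *)
pose Q' x y : {poly R} := \poly_(i < d.+1) (Q x y)`_i.
have fQ' : polyfam K N d.+1 Q'.
  split=> [? ?|i]; first exact: size_poly.
  apply: (polyfun_ext (fun x y => coef_poly _ _ _)).
  by case: (i < d.+1)%N; [apply: fQ.2 | apply: polyfun_cst; exact: subring_0].
have Q'z : Q' x y = Q x y.
  apply/polyP => i; rewrite coef_poly; case: ltnP => // di.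
  by rewrite nth_default// sQ ds.
have lc : (Q' x y)`_d != 0.
  by rewrite Q'z; move: Q0; rewrite -lead_coef_eq0 lead_coefE sQ ds.
rewrite -Q'z in Qy Q0 sQ.
(* The derivative has smaller degree, so by minimality it would be zero; but its leading coefficient
   is [d] times that of [Q'], in characteristic zero. *)
have dQy : (Q' x y)^`().[y N] != 0.
  apply/eqP => dQy0.
  have fdQ : polyfam K N d.+1 (fun x y => (Q' x y)^`()).
    split=> [x' y'|i]; first by rewrite size_deriv (leq_trans (leq_pred _))// fQ'.1.
    apply: (polyfun_ext (fun x y => coef_deriv _ _)).
    apply: (polyfun_ext (fun x y => esym (mulr_natr _ _))).
    apply: polyfun_mul; first exact: fQ'.2.
    apply: polyfun_cst; elim: i.+1 => [|m IHm]; first exact: subring_0.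
    by rewrite mulrS; apply: subring_D.
  have := dmin _ _ fdQ dQy0; rewrite size_deriv sQ ds => /(_ (leqnn _)).
  move/polyP/(_ d.-1); rewrite coef_deriv coef0 prednK// => /eqP.
  by rewrite mulrn_eq0 (negPf lc) orbF eqn0Ngt d0.
(* The remainder [S] has size at most [d] and root [y N], so by minimality it is zero at the point.
   Being a family in the first [N] unknowns, it can be kept zero nearby. *)
have [m [S [fS SE]]] := polyfam_pseudo_div K1 KB d0 fQ' fP.
have Sz : S x y = 0.
  apply: (dmin _ _ fS); last exact: fS.1.
  by rewrite -SE// -fE f0 mulr0.
have [t1 [t2 [t1e t2e t12 Qt]]] := simple_root_sign_change e0 Qy dQy.
pose a1 := (Q' x y).[t1]; pose a2 := (Q' x y).[t2].
have a10 : 0 < `|a1|.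
  by rewrite normr_gt0; apply: contraTneq Qt => a10; rewrite -/a1 a10 mul0r ltxx.
have a20 : 0 < `|a2|.
  by rewrite normr_gt0; apply: contraTneq Qt => a20; rewrite -/a2 a20 mulr0 ltxx.
have [h1 h10 H1] := polyfam_horner_continuous x y t1 fQ' a10.
have [h2 h20 H2] := polyfam_horner_continuous x y t2 fQ' a20.
have [|h3 h30 H3] := @polyfun_continuous _ K _ N _ x y `|(Q' x y)`_d| (fQ'.2 d).
  by rewrite normr_gt0.
pose h := Num.min (Num.min h1 h2) h3.
have h0 : 0 < h by rewrite !lt_min h10 h20.
have eh0 : 0 < Num.min e h by rewrite lt_min e0.
(* The earlier unknowns must stay within [e], and also move too little to disturb the signs at [t1]
   and [t2] or the leading coefficient. *)
have [h4 h40 H4] := liftable_vanishing fS Sz lz eh0.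
exists (Num.min h4 h); first by rewrite lt_min h40.
move=> x' Cx' xx'.
have [i|y' Sy' yy'] := H4 x' Cx'; first by have := xx' i; rewrite lt_min => /andP[].
have xh i : `|x' i - x i| < h by have := xx' i; rewrite lt_min => /andP[].
have yh n : (n < N)%N -> `|y' n - y n| < h by move=> /yy'; rewrite lt_min => /andP[].
have {H1}H1 : `|(Q' x' y').[t1] - a1| < `|a1|.
  by apply: H1 => [i|n /yh]; [have := xh i|]; rewrite !lt_min => /andP[/andP[]].
have {H2}H2 : `|(Q' x' y').[t2] - a2| < `|a2|.
  by apply: H2 => [i|n /yh]; [have := xh i|]; rewrite !lt_min => /andP[/andP[]].
have {}H3 : `|(Q' x' y')`_d - (Q' x y)`_d| < `|(Q' x y)`_d|.
  by apply: H3 => [i|n /yh]; [have := xh i|]; rewrite !lt_min => /andP[].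
have {}H3 : (Q' x' y')`_d != 0.
  by apply: contraTneq H3 => ->; rewrite sub0r normrN ltxx.
have : (Q' x' y').[t1] * (Q' x' y').[t2] < 0.
  move: H1 H2 Qt; rewrite -/a1 -/a2; move: a1 a2 _.[t1] _.[t2] {a10 a20 h10 h20} => a b a' b'.
  have [a0|a0|->] := ltgtP a 0; last by rewrite normr0 ltNge normr_ge0.
  - rewrite (ltr0_norm a0) ltr_distl => /andP[_ aa].
    rewrite nmulr_rlt0// => + b0; rewrite (gtr0_norm b0) ltr_distl => /andP[bb _].
    by rewrite nmulr_rlt0; lra.
  - rewrite (gtr0_norm a0) ltr_distl => /andP[aa _].
    rewrite pmulr_rlt0// => + b0; rewrite (ltr0_norm b0) ltr_distl => /andP[_ bb].
    by rewrite pmulr_rlt0; lra.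
move/(poly_ivtoo t12) => [t]; rewrite itv_boundlr /= => /andP[t1t tt2] /eqP Qt0.
(* At the root [t] of [Q'], a power of its nonzero leading coefficient times [P] equals [S], which
   is zero; so [t] is a root of [P]. *)
exists (upd N y' t).
  have := SE _ _ _ Qt0; rewrite Sy' horner0 => /eqP.
  rewrite mulf_eq0 expf_eq0 (negPf H3) andbF/= => /eqP.
  by rewrite fE updN (polyfam_upd _ _ _ fP).
move=> n; rewrite ltnS leq_eqVlt => /predU1P[->|nN]; last first.
  by rewrite upd_small//; have := yy' n nN; rewrite lt_min => /andP[].
rewrite updN; move: t1e t2e t1t tt2; rewrite !ltr_distl !lteBSide/= => /andP[? _] /andP[_ ?] ? ?.
by apply/andP; split; lra.
Qed.

(** Without unknowns this is genericity itself; the unknowns are then added one by one. *)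
Lemma generic_liftable (x : I -> R) :
  (forall f : fn, polyfun K 0 f -> forall y, f x y = 0 ->
     forall x', C x' -> f x' y = 0) ->
  forall N y, liftable N x y.
Proof.
move=> gx N y; elim: N => [|N]; last exact: liftableS.
by move=> f Pf f0 e e0; exists 1 => // x' Cx' _; exists y => //; apply: gx f0 _ Cx'.
Qed.

End Lifting.

(** * Compactness in finite dimension *)

Section Compactness.
Import numFieldNormedType.Exports.
Variables (R : realType) (J : finType).

(** Bolzano-Weierstrass in terms of a cluster point: closed conditions pass to it without extracting
    a subsequence. *)
Lemma bounded_cluster (M : R) (u : nat -> J -> R) :
  (forall n j, `|u n j| <= M) ->
  exists l : J -> R, forall e, 0 < e -> forall n0,
    exists2 n, (n0 <= n)%N & forall j, `|u n j - l j| < e.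
Proof.
move=> uM; pose v n : 'rV[R]_#|J| := \row_i u n (enum_val i).
have FF : ProperFilter (v @ \oo)%classic by apply: fmap_proper_filter.
have [] := @rV_compact _ #|J| (fun _ => `[-M, M]%classic)
  (fun _ => @segment_compact R (- M) M) (v @ \oo)%classic FF.
  by exists 0%N => // n _ j /=; rewrite mxE in_itv/= -ler_norml uM.
move=> l [_ cl]; exists (fun j => l 0 (enum_rank j)) => e e0 n0.
have FA : (v @ \oo)%classic [set w | exists2 n, (n0 <= n)%N & v n = w]%classic.
  by exists n0 => // n /= n0n; exists n.
have lB : nbhs l [set w | forall j, ball (l 0 j) e (w 0 j)]%classic.
  exists (fun i j => ball (l i j) e) => /= [i j|w wl j]; first exact: nbhsx_ballx.
  exact: wl.
have [w [[n n0n <-] wl]] := cl _ _ FA lB.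
exists n => // j; have := wl (enum_rank j).
by rewrite /ball/= mxE enum_rankK distrC.
Qed.

Definition seq_closed (S : (J -> R) -> Prop) := forall l,
  (forall e, 0 < e -> exists2 b, S b & forall j, `|b j - l j| < e) -> S l.

(** Extreme value theorem: a cluster point of a minimising sequence attains the infimum. *)
Lemma exists_minimizer (S : (J -> R) -> Prop) (phi : (J -> R) -> R) (M : R) :
  (exists b, S b) -> (forall b j, S b -> `|b j| <= M) -> seq_closed S ->
  (forall b, 0 <= phi b) ->
  (forall b e, 0 < e -> exists2 h, 0 < h &
    forall b', (forall j, `|b' j - b j| < h) -> `|phi b' - phi b| < e) ->
  exists2 b, S b & forall b', S b' -> phi b <= phi b'.
Proof.
move=> [b0 Sb0] SM Scl phi0 phic.
pose A := [set phi b | b in S]%classic.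
have hA : has_inf A by split; [exists (phi b0), b0|exists 0 => _ [b _ <-]].
have /choice[u uP] : forall n : nat, exists b, S b /\ phi b < inf A + n.+1%:R^-1.
  move=> n; have n0 : 0 < n.+1%:R^-1 :> R by rewrite invr_gt0 ltr0n.
  by have [_ [b Sb <-] bA] := inf_adherent n0 hA; exists b.
have [l lP] := @bounded_cluster M u (fun n j => SM _ j (uP n).1).
have Sl : S l.
  by apply: Scl => e e0; have [n _ ul] := lP e e0 0%N; exists (u n) => //; case: (uP n).
exists l => // b' Sb'.
have infb : inf A <= phi b' by apply: ge_inf; [case: hA | exists b'].
apply: le_trans infb; apply/ler_addgt0Pr => e e0.
have e20 : 0 < e / 2 by rewrite divr_gt0.
have [h h0 H] := phic l _ e20.
have [n0 n0e] : exists n0 : nat, n0.+1%:R^-1 < e / 2.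
  exists (Num.bound (e / 2)^-1); rewrite invf_plt ?posrE ?ltr0n//.
  apply: lt_trans (archi_boundP _) _; first by rewrite invr_ge0 ltW.
  by rewrite ltr_nat.
have [n n0n /H] := lP h h0 n0.
rewrite ltr_distl => /andP[lu _]; have [_ un] := uP n.
have : n.+1%:R^-1 <= n0.+1%:R^-1 :> R by rewrite lef_pV2 ?posrE ?ltr0n// ler_nat ltnS.
move: un n0e; move: (_^-1) (_^-1) => x y.
by lra.
Qed.

End Compactness.

(** * Gram matrices and Laplacians *)

Section Gram.
Variable R : realType.

Lemma mxE11 (M : 'M[R]_1) : M = (M 0 0)%:M.
Proof. by rewrite {1}[M]mx11_scalar. Qed.

Lemma rv_sqr_ge0 n (x : 'rV[R]_n) : 0 <= (x *m x^T) 0 0.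
Proof. by rewrite mxE sumr_ge0// => i _; rewrite mxE -expr2 sqr_ge0. Qed.

Lemma rv_sqr_eq0 n (x : 'rV[R]_n) : (x *m x^T) 0 0 = 0 -> x = 0.
Proof.
rewrite mxE => /eqP; rewrite psumr_eq0; last first.
  by move=> i _; rewrite mxE -expr2 sqr_ge0.
move=> /allP x0; apply/rowP => i; rewrite mxE.
by have := x0 i (mem_index_enum _); rewrite /= mxE -expr2 sqrf_eq0 => /eqP.
Qed.

(** Cholesky factorisation by induction. A zero pivot forces its row to vanish; a positive one
    leaves the Schur complement, again positive semidefinite. *)
Lemma psd_gram_mx n (M : 'M[R]_n) : M^T = M -> psd M ->
  exists U : 'M[R]_n, M = U *m U^T.
Proof.
elim: n M => [|n IHn] M Msym Mpsd; first by exists 0; rewrite !thinmx0.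
rewrite -[n.+1]/(1 + n)%N in M Msym Mpsd *.
pose a : R := ulsubmx M 0 0; pose b := ursubmx M; pose D := drsubmx M.
have ME : M = block_mx a%:M b b^T D.
  rewrite -[M]submxK [ulsubmx M]mxE11 -/a -/b -/D; congr block_mx.
  by rewrite /b -[in LHS]Msym trmx_ursub.
have Dsym : D^T = D by rewrite /D -[in RHS]Msym trmx_drsub.
have qE s (y : 'cV_n) : 0 <= a * s ^+ 2 + s * (b *m y) 0 0 *+ 2 + (y^T *m D *m y) 0 0.
  have := Mpsd (col_mx (s%:M : 'M_1) y).
  rewrite ME tr_col_mx tr_scalar_mx mul_row_block mul_row_col.
  rewrite !mulmxDl -!scalar_mxM -trmx_mul mul_mx_scalar mul_scalar_mx -scalemxAl.
  move: (b *m y) (y^T *m D *m y) => z w.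
  rewrite !mxE eqxx !mulr1n.
  by congr (0 <= _); ring.
have a0 : 0 <= a.
  by have := qE 1 0; rewrite expr1n mulr1 mulmx0 trmx0 mul0mx mul0mx !mxE mulr0 mul0rn !addr0.
have [a00|aN0] := eqVneq a 0.
  have b0 : b = 0.
    apply: rv_sqr_eq0; apply/eqP/negPn/negP => bb.
    have bb0 : 0 < (b *m b^T) 0 0 by rewrite lt_neqAle eq_sym bb rv_sqr_ge0.
    (* With this [s] the form takes the value [-2 - b D b^T], which is negative since [D] is
       positive semidefinite. *)
    have := qE (- (1 + (b^T^T *m D *m b^T) 0 0) / (b *m b^T) 0 0) b^T.
    by rewrite a00 mul0r add0r divfK// -mulr_natr; have := qE 0 b^T;
       rewrite mul0r mul0rn expr0n mulr0 !add0r; lra.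
  have [|U UE] := IHn D Dsym.
    by move=> y; have := qE 0 y; rewrite mul0r mul0rn expr0n mulr0 !add0r.
  exists (block_mx (0 : 'M_1) 0 0 U).
  rewrite tr_block_mx mulmx_block !(trmx0, mul0mx, mulmx0, add0r) -UE ME a00 b0 trmx0.
  by congr block_mx; apply/matrixP => i j; rewrite !mxE mul0rn.
have a_gt0 : 0 < a by rewrite lt_neqAle eq_sym aN0.
have [||U UE] := IHn (D - a^-1 *: (b^T *m b)).
- by rewrite linearB linearZ/= trmx_mul trmxK Dsym.
(* This [s] minimises the form for fixed [y]; the minimum is the form of the Schur complement. *)
- move=> y; have := qE (- (b *m y) 0 0 / a) y.
  rewrite (_ : _ *m (_ - _) *m _ =
    y^T *m D *m y - a^-1 *: ((b *m y)^T *m (b *m y))); last first.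
    by rewrite trmx_mul mulmxBr mulmxBl -scalemxAr -scalemxAl !mulmxA.
  move: (b *m y) (y^T *m D *m y) => z w.
  rewrite !mxE big_ord1 !mxE; congr (0 <= _).
  by field.
pose s := Num.sqrt a.
have s0 : s != 0 by rewrite sqrtr_eq0 -ltNge.
have ss : s * s = a by rewrite -expr2 sqr_sqrtr.
exists (block_mx s%:M 0 (s^-1 *: b^T) U).
rewrite tr_block_mx mulmx_block tr_scalar_mx !(trmx0, mul0mx, mulmx0, addr0).
rewrite -scalar_mxM ss ME mul_scalar_mx mul_mx_scalar linearZ/= trmxK !scalerA.
rewrite mulfV// !scale1r -scalemxAl -scalemxAr scalerA -invfM ss -UE.
by rewrite addrC subrK.
Qed.

Lemma psd_gram (V : finType) (S : V -> V -> R) : (forall i j, S i j = S j i) ->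
  (forall w : V -> R, 0 <= \sum_i \sum_j w i * w j * S i j) ->
  exists u : V -> 'I_#|V| -> R, forall i j, S i j = \sum_k u i k * u j k.
Proof.
move=> Ssym Spsd; pose M : 'M[R]_#|V| := \matrix_(i, j) S (enum_val i) (enum_val j).
have [||U UE] := @psd_gram_mx _ M.
- by apply/matrixP => i j; rewrite !mxE Ssym.
- move=> x; have := Spsd (fun i => x (enum_rank i) 0).
  rewrite (_ : \sum_i _ = (x^T *m M *m x) 0 0)//.
  rewrite mxE (reindex_omap (@enum_val _ V) (fun i => Some (enum_rank i))); last first.
    by move=> i _ /=; rewrite enum_rankK.
  rewrite (eq_bigl xpredT) => [|j]; last by rewrite enum_valK eqxx.
  transitivity (\sum_j \sum_i x j 0 * x i 0 * M j i).
    apply: eq_bigr => j _.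
    rewrite (reindex_omap (@enum_val _ V) (fun i => Some (enum_rank i))); last first.
      by move=> i _ /=; rewrite enum_rankK.
    rewrite (eq_bigl xpredT) => [|i]; last by rewrite enum_valK eqxx.
    by apply: eq_bigr => i _; rewrite !enum_valK mxE.
  rewrite exchange_big; apply: eq_bigr => j _ /=; rewrite mxE mulr_suml.
  by apply: eq_bigr => i _; rewrite [x^T _ _]mxE; ring.
exists (fun i => U (enum_rank i)) => i j.
have := congr1 (fun A : 'M_ _ => A (enum_rank i) (enum_rank j)) UE.
by rewrite !mxE !enum_rankK => ->; apply: eq_bigr => k _; rewrite mxE.
Qed.

End Gram.

Section Distances.
Variable R : realType.

Definition sqdist k (x y : 'cV[R]_k) : R := \sum_(a < k) (x a 0 - y a 0) ^+ 2.

Lemma sqdist_ge0 k (x y : 'cV[R]_k) : 0 <= sqdist x y.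
Proof. by apply: sumr_ge0 => a _; rewrite sqr_ge0. Qed.

Lemma edist_le k l (x y : 'cV[R]_k) (x' y' : 'cV[R]_l) :
  (Defs.edist x y <= Defs.edist x' y') = (sqdist x y <= sqdist x' y').
Proof. exact/ler_sqrt/sqdist_ge0. Qed.

Lemma edist_eqP k l (x y : 'cV[R]_k) (x' y' : 'cV[R]_l) :
  Defs.edist x y = Defs.edist x' y' <-> sqdist x y = sqdist x' y'.
Proof.
by split=> [/eqP|/eqP]; rewrite eq_le => E; apply/eqP; rewrite eq_le;
   rewrite !edist_le in E *.
Qed.

End Distances.

Section AffineSpan.
Variables (R : realType) (V : finType) (d : nat).
Implicit Type p : V -> 'cV[R]_d.

(** The form vanishes at affine combinations, hence everywhere; the origin and the unit vectors then
    give its coefficients. *)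
Lemma affine_form_eq0 (A : pred V) p (c : R) (b : 'I_d -> R) :
  affinely_spans A p -> (forall j, A j -> c + \sum_a b a * p j a 0 = 0) ->
  c = 0 /\ forall a, b a = 0.
Proof.
move=> Ap H.
have Hx (x : 'cV_d) : c + \sum_a b a * x a 0 = 0.
  have [lam [lamA [lam1 <-]]] := Ap x.
  rewrite -[c]mulr1 -lam1 mulr_sumr.
  under [X in _ + X]eq_bigr => a _ do rewrite summxE mulr_sumr.
  rewrite exchange_big -big_split/= big1// => j _.
  have [Aj|/lamA ->] := boolP (A j); last first.
    by rewrite mulr0 add0r big1// => a _; rewrite scale0r mxE mulr0.
  transitivity (lam j * (c + \sum_a b a * p j a 0)); last by rewrite H ?mulr0.
  rewrite mulrDr mulrC mulr_sumr; congr (_ + _).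
  by apply: eq_bigr => a _; rewrite mxE mulrCA.
have c0 : c = 0.
  by have := Hx 0; rewrite big1 ?addr0// => a _; rewrite mxE mulr0.
split=> // a; have := Hx (delta_mx a 0); rewrite c0 add0r.
rewrite (bigD1 a)//= mxE !eqxx mulr1 big1 ?addr0// => a' a'a.
by rewrite mxE (negPf a'a) mulr0.
Qed.

Lemma affinely_spansW (A B : pred V) p : (forall i, A i -> B i) ->
  affinely_spans A p -> affinely_spans B p.
Proof.
move=> AB Ap x; have [lam [lamA lamE]] := Ap x; exists lam; split=> // j.
by move=> Bj; apply: lamA; apply: contra Bj; apply: AB.
Qed.

End AffineSpan.

(** * Kernel and rank of the stress Laplacian *)

Section Laplacian.
Variables (R : realType) (V : finType) (G : rel V) (omega : V -> V -> R).
Hypotheses (Gsym : symmetric G) (omega_sym : stress_on G omega).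

Definition lap (f : V -> R) (i : V) : R := \sum_(j | G i j) omega i j * (f i - f j).

Definition vec_of (f : V -> R) : 'cV[R]_#|V| := \col_k f (enum_val k).

Lemma evec_dot i (f : V -> R) : (evec R i)^T *m vec_of f = (f i)%:M.
Proof.
by rewrite trmx_delta -rowE; apply/matrixP => a b; rewrite !ord1 !mxE enum_rankK.
Qed.

Lemma evecB_dot i j (f : V -> R) :
  (evec R i - evec R j)^T *m vec_of f = (f i - f j)%:M.
Proof. by rewrite [(_ - _)^T]linearB/= mulmxBl !evec_dot [RHS]raddfB. Qed.

Lemma laplacian_mul (f : V -> R) : laplacian G omega *m vec_of f = vec_of (lap f).
Proof.
rewrite -scalemxAl mulmx_suml; apply/colP => k; rewrite !mxE summxE.
rewrite -[k]enum_valK; move: (enum_val k) => i; rewrite enum_rankK.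
transitivity (2^-1 * \sum_(e : V * V | G e.1 e.2)
    omega e.1 e.2 * ((i == e.1)%:R - (i == e.2)%:R) * (f e.1 - f e.2)).
  congr (_ * _); apply: eq_bigr => e _.
  rewrite -scalemxAl -mulmxA evecB_dot mul_mx_scalar mxE -mulrA; congr (_ * _).
  by rewrite mxE mulrC; congr (_ * _); rewrite !mxE !andbT !(inj_eq enum_rank_inj).
under eq_bigr do rewrite -mulrA mulrBl mulrBr !mulrA.
rewrite sumrB.
(* Each of the two endpoints of an ordered edge contributes [lap f i], which cancels the factor
   1/2. *)
have -> : \sum_(e : V * V | G e.1 e.2) omega e.1 e.2 * (i == e.1)%:R * (f e.1 - f e.2)
    = lap f i.
  rewrite -(pair_big_dep predT G (fun u v => omega u v * (i == u)%:R * (f u - f v)))/=.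
  rewrite (bigD1 i)//= [X in _ + X]big1 ?addr0 => [|u ui].
    by apply: eq_bigr => v _; rewrite eqxx mulr1.
  by apply: big1 => v _; rewrite eq_sym (negPf ui) mulr0 mul0r.
have -> : \sum_(e : V * V | G e.1 e.2) omega e.1 e.2 * (i == e.2)%:R * (f e.1 - f e.2)
    = - lap f i.
  rewrite -(pair_big_dep predT G (fun u v => omega u v * (i == v)%:R * (f u - f v)))/=.
  rewrite (exchange_big_dep predT)//= (bigD1 i)//= [X in _ + X]big1 ?addr0 => [|u ui].
    rewrite /lap -sumrN (eq_bigl (G i)); last by move=> v; rewrite Gsym.
    by apply: eq_bigr => v iv; rewrite eqxx mulr1 omega_sym 1?Gsym// -mulrN opprB.
  by apply: big1 => v _; rewrite eq_sym (negPf ui) mulr0 mul0r.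
by rewrite opprK; field.
Qed.

Lemma vec_of_eq0 (f : V -> R) : vec_of f = 0 <-> forall i, f i = 0.
Proof.
split=> [f0 i|f0]; last by apply/colP => k; rewrite !mxE.
by have /colP/(_ (enum_rank i)) := f0; rewrite !mxE enum_rankK.
Qed.

Lemma vec_ofP (x : 'cV[R]_#|V|) : exists f, x = vec_of f.
Proof.
by exists (fun i => x (enum_rank i) 0); apply/colP => k; rewrite mxE enum_valK.
Qed.

(** Twice the quadratic form of the Laplacian, as edges are counted in both directions. *)
Definition energy (f : V -> R) : R :=
  \sum_i \sum_(j | G i j) omega i j * (f i - f j) ^+ 2.

Lemma laplacian_form (f : V -> R) :
  ((vec_of f)^T *m laplacian G omega *m vec_of f) 0 0 = 2^-1 * energy f.
Proof.
rewrite -scalemxAr -scalemxAl mxE; congr (_ * _).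
rewrite mulmx_sumr mulmx_suml summxE /energy pair_big_dep /=.
apply: eq_bigr => e _; rewrite -scalemxAr -scalemxAl mxE; congr (_ * _).
rewrite !mulmxA -[_ *m _ *m vec_of f]mulmxA evecB_dot.
have -> : (vec_of f)^T *m (evec R e.1 - evec R e.2) = (f e.1 - f e.2)%:M.
  by rewrite -[LHS]trmxK trmx_mul trmxK evecB_dot tr_scalar_mx.
by rewrite -scalar_mxM mxE eqxx mulr1n expr2.
Qed.

Lemma laplacian_sym : (laplacian G omega)^T = laplacian G omega.
Proof.
rewrite linearZ/= linear_sum/=; congr (_ *: _); apply: eq_bigr => e _.
by rewrite linearZ/= trmx_mul trmxK.
Qed.

Lemma psd_laplacianP :
  psd (laplacian G omega) <-> forall f, 0 <= energy f.
Proof.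
have h0 : 0 < 2^-1 :> R by rewrite invr_gt0 ltr0n.
split=> [Lpsd f|E x].
  by have := Lpsd (vec_of f); rewrite laplacian_form (pmulr_rge0 _ h0).
by have [f ->] := vec_ofP x; rewrite laplacian_form (pmulr_rge0 _ h0).
Qed.

(** With [L = U U^T] the form is the squared norm of [U^T f], so its zeros lie in the kernel of
    [L]. *)
Lemma energy_eq0_lap (f : V -> R) : (forall g, 0 <= energy g) ->
  energy f = 0 -> forall i, lap f i = 0.
Proof.
move=> E f0; apply/vec_of_eq0; rewrite -laplacian_mul.
have [U UE] := psd_gram_mx laplacian_sym (proj2 psd_laplacianP E).
have : (((vec_of f)^T *m U) *m ((vec_of f)^T *m U)^T) 0 0 = 0.
  by rewrite trmx_mul trmxK mulmxA -(mulmxA _ U) -UE laplacian_form f0 mulr0.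
move/rv_sqr_eq0 => fU; rewrite UE -mulmxA.
by rewrite -[U^T *m _]trmxK trmx_mul trmxK fU trmx0 mulmx0.
Qed.

Lemma energy_lap0D (f h : V -> R) : (forall i, lap h i = 0) ->
  energy (fun i => f i + h i) = energy f.
Proof.
move=> h0; have h20 : (2^-1 : R) != 0 by rewrite invr_eq0 pnatr_eq0.
apply: (mulfI h20); rewrite -!laplacian_form.
have -> : vec_of (fun i => f i + h i) = vec_of f + vec_of h.
  by apply/colP => k; rewrite !mxE.
have Lh : laplacian G omega *m vec_of h = 0 by rewrite laplacian_mul (proj2 (vec_of_eq0 _) h0).
have hL : (vec_of h)^T *m laplacian G omega = 0.
  by rewrite -laplacian_sym -trmx_mul Lh trmx0.
by rewrite [(_ + _)^T]linearD/= mulmxDl hL addr0 mulmxDr -[X in _ + X]mulmxA Lh mulmx0 addr0.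
Qed.

Lemma energy_lap0 (h : V -> R) : (forall i, lap h i = 0) -> energy h = 0.
Proof.
move=> h0; transitivity (energy (fun _ => 0)).
  rewrite -(energy_lap0D (fun _ => 0) h0); congr energy.
  by apply/funext => i; rewrite add0r.
by apply: big1 => i _; apply: big1 => j _; rewrite subrr expr0n mulr0.
Qed.

Section Kernel.
Variables (d : nat) (p : V -> 'cV[R]_d).
Hypotheses (eqp : equilibrium_stress G omega p) (psp : affinely_spans predT p).

Let aff (c : R) (b : 'I_d -> R) i := c + \sum_a b a * p i a 0.

(** The row space consists of the affine functions of [p], seen as functions on [V]. *)
Let P : 'M[R]_(1 + d, #|V|) :=
  col_mx (const_mx 1) (\matrix_(a, k) p (enum_val k) a 0).

Let PE (x : 'rV[R]_(1 + d)) :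
  x *m P = (vec_of (aff (x 0 (lshift d 0)) (fun a => x 0 (rshift 1 a))))^T.
Proof.
rewrite -[x in LHS]hsubmxK mul_row_col; apply/rowP => k; rewrite !mxE big_ord1 !mxE mulr1.
by congr (_ + _); apply: eq_bigr => a _; rewrite !mxE.
Qed.

Let P_free : row_free P.
Proof.
rewrite -kermx_eq0; apply/eqP/row_matrixP => r; rewrite row0.
set x := row r _; have : x *m P = 0 by rewrite /x -row_mul mulmx_ker row0.
rewrite PE => /(congr1 trmx); rewrite trmxK trmx0 => /vec_of_eq0 H.
have [x0 xa] := affine_form_eq0 psp (fun j _ => H j).
apply/rowP => i; rewrite [RHS]mxE -(splitK i); case: (split i) => [j|a] //=.
by rewrite ord1.
Qed.

(** Orthogonal projection onto the affine functions of [p]: the normal equations are solvable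
    because spanning makes [P P^T] invertible. *)
Lemma affine_projection (f : V -> R) : exists c (b : 'I_d -> R),
  let g i := f i - (c + \sum_a b a * p i a 0) in
  \sum_i g i = 0 /\ forall a, \sum_i p i a 0 * g i = 0.
Proof.
have PPu : P *m P^T \in unitmx.
  rewrite -row_free_unit -kermx_eq0; apply/eqP/row_matrixP => r; rewrite row0.
  set x := row r _; have : x *m (P *m P^T) = 0 by rewrite /x -row_mul mulmx_ker row0.
  move=> xPP; apply/eqP; rewrite -(mulmx_free_eq0 _ P_free); apply/eqP/rv_sqr_eq0.
  by rewrite trmx_mul mulmxA -(mulmxA x) xPP mul0mx mxE.
have [x xE] : exists x, x *m (P *m P^T) = (vec_of f)^T *m P^T.
  by exists ((vec_of f)^T *m P^T *m invmx (P *m P^T)); rewrite mulmxKV.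
exists (x 0 (lshift d 0)), (fun a => x 0 (rshift 1 a)) => g.
have gE : (vec_of g)^T *m P^T = 0.
  have -> : (vec_of g)^T = (vec_of f)^T - x *m P.
    by rewrite PE; apply/rowP => k; rewrite !mxE.
  by rewrite mulmxBl -[_ *m P *m _]mulmxA xE subrr.
have gP r : \sum_k P r k * g (enum_val k) = 0.
  have /matrixP/(_ 0 r) := gE; rewrite !mxE; apply: etrans.
  by apply: eq_bigr => k _; rewrite !mxE mulrC.
split=> [|a].
  rewrite (reindex _ (onW_bij _ (@enum_val_bij V))); apply: etrans (gP (lshift d 0)).
  by apply: eq_bigr => k _; rewrite col_mxEu mxE mul1r.
rewrite (reindex _ (onW_bij _ (@enum_val_bij V))); apply: etrans (gP (rshift 1 a)).
by apply: eq_bigr => k _; rewrite col_mxEd mxE.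
Qed.

Lemma lap_affine c b i : lap (fun i => c + \sum_a b a * p i a 0) i = 0.
Proof.
have eqa a : \sum_(j | G i j) omega i j * (p i a 0 - p j a 0) = 0.
  have /colP/(_ a) := eqp i; rewrite summxE [RHS]mxE; apply: etrans.
  by apply: eq_bigr => j _; rewrite !mxE.
transitivity (\sum_a b a * \sum_(j | G i j) omega i j * (p i a 0 - p j a 0)); last first.
  by rewrite big1// => a _; rewrite eqa mulr0.
under [RHS]eq_bigr do rewrite mulr_sumr.
rewrite exchange_big /lap; apply: eq_bigr => j _ /=.
rewrite opprD addrACA subrr add0r -sumrB mulr_sumr.
by apply: eq_bigr => a _; ring.
Qed.

Let PL : P *m laplacian G omega = 0.
Proof.
apply/row_matrixP => r; rewrite row0 row_mul rowE -[_ *m _]trmxK -[RHS]trmxK; congr trmx.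
rewrite trmx_mul laplacian_sym PE trmxK laplacian_mul trmx0.
by apply/vec_of_eq0 => i; apply: lap_affine.
Qed.

(** Ensures that the subtraction [#|V| - d.+1] in the rank condition does not truncate. *)
Lemma card_ge_span : (d.+1 <= #|V|)%N.
Proof. by have := rank_leq_col P; rewrite (eqP P_free). Qed.

(** The kernel always contains the [d.+1]-dimensional space of affine functions of [p]; the rank is
    the prescribed one exactly when it contains nothing else. *)
Lemma laplacian_rankP : \rank (laplacian G omega) = (#|V| - d.+1)%N <->
  forall f, (forall i, lap f i = 0) ->
    exists c (b : 'I_d -> R), forall i, f i = c + \sum_a b a * p i a 0.
Proof.
have Pker : (P <= kermx (laplacian G omega))%MS by apply/sub_kermxP; apply: PL.
have rkP : \rank P = d.+1 by have /eqP := P_free.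
have kerE : \rank (kermx (laplacian G omega)) = (#|V| - \rank (laplacian G omega))%N.
  exact: mxrank_ker.
split=> [rk f f0|H].
  have : (kermx (laplacian G omega) <= P)%MS.
    by rewrite -(geq_leqif (mxrank_leqif_sup Pker)) rkP kerE rk subKn ?card_ge_span.
  move=> kP; have : ((vec_of f)^T <= kermx (laplacian G omega))%MS.
    apply/sub_kermxP; rewrite -laplacian_sym -trmx_mul laplacian_mul.
    by rewrite (proj2 (vec_of_eq0 _) f0) trmx0.
  move=> /submx_trans/(_ kP).
  move=> /submxP[x xE]; exists (x 0 (lshift d 0)), (fun a => x 0 (rshift 1 a)) => i.
  have /colP/(_ (enum_rank i)) : vec_of f = (x *m P)^T by rewrite -xE trmxK.
  by rewrite PE trmxK !mxE enum_rankK.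
have : (kermx (laplacian G omega) <= P)%MS.
  apply/row_subP => r; set x := row r _.
  have : x *m laplacian G omega = 0 by rewrite /x -row_mul mulmx_ker row0.
  have [f fE] := vec_ofP x^T; rewrite -[x]trmxK fE -laplacian_sym -trmx_mul.
  rewrite laplacian_mul => /(congr1 trmx); rewrite trmxK trmx0 => /vec_of_eq0/H[c [b cb]].
  apply/submxP; exists (row_mx c%:M (\row_a b a)); rewrite PE; congr trmx.
  apply/colP => k; rewrite [LHS]mxE cb [RHS]mxE /aff row_mxEl mxE eqxx mulr1n; congr (_ + _).
  by apply: eq_bigr => a _; rewrite row_mxEr mxE.
move=> kP; have : \rank (kermx (laplacian G omega)) = d.+1.
  by rewrite -rkP; apply/eqP; rewrite eqn_leq !mxrankS.
by rewrite kerE => <-; rewrite subKn// rank_leq_row.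
Qed.

End Kernel.
End Laplacian.

(** * A stress implies universal rigidity *)

Section Sufficiency.
Variables (R : realType) (V : finType).

Lemma sum_sqrB (I : finType) (x y : I -> R) :
  \sum_i (x i - y i) ^+ 2 =
  \sum_i x i * x i + \sum_i y i * y i - (\sum_i x i * y i) *+ 2.
Proof.
rewrite -sumrMnl -sumrN -!big_split/=; apply: eq_bigr => i _; ring.
Qed.

Variables (G : rel V) (sigma : V -> V -> int).
Hypothesis tG : tensegrity G sigma.

Lemma sign_cases i j : G i j -> [\/ Eplus G sigma i j /\ sigma i j = 1,
  E0 G sigma i j /\ sigma i j = 0 | Eminus G sigma i j /\ sigma i j = -1].
Proof.
move=> Gij; rewrite /Eplus /E0 /Eminus Gij.
have [_ ] := tG.2 i j Gij; rewrite !inE => /or3P[] /eqP ->.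
- exact: Or33.
- exact: Or32.
- exact: Or31.
Qed.

Variables (omega : V -> V -> R) (d : nat) (p : V -> 'cV[R]_d).
Hypotheses (omega_sym : stress_on G omega)
  (eqp : equilibrium_stress G omega p) (strict : strictly_proper G sigma omega)
  (omega_psd : psd (laplacian G omega))
  (omega_rank : \rank (laplacian G omega) = (#|V| - d.+1)%N).

Let Gsym : symmetric G. Proof. exact: tG.1.2. Qed.

Lemma sum_energy k (q : V -> 'cV[R]_k) :
  \sum_b energy G omega (fun i => q i b 0) =
  \sum_i \sum_(j | G i j) omega i j * sqdist (q i) (q j).
Proof.
rewrite exchange_big; apply: eq_bigr => i _.
rewrite exchange_big; apply: eq_bigr => j _.
by rewrite -mulr_sumr.
Qed.

(** Weighted by the stress, the squared lengths of [p] minus those of [q] are termwise nonnegative.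
    By equilibrium the energy of [p] is zero, so they sum to minus the energy of [q], which is at
    most zero; everything vanishes. *)
Lemma dominated_edge_eq k (q : V -> 'cV[R]_k) : affinely_spans predT p ->
  dominates G sigma p q ->
  (forall i j, G i j -> sqdist (q i) (q j) = sqdist (p i) (p j)) /\
  (forall b, energy G omega (fun i => q i b 0) = 0).
Proof.
move=> psp dom.
pose t i j := omega i j * (sqdist (p i) (p j) - sqdist (q i) (q j)).
have E0g f : 0 <= energy G omega f by move: f; apply/psd_laplacianP.
have tge0 i j : G i j -> 0 <= t i j.
  move=> Gij; have [_ str] := strict Gij; rewrite /t.
  have [dp [d0 dm]] := dom i j.
  have [[e s]|[e s]|[e s]] := sign_cases Gij; move: str; rewrite s.
  - rewrite mul1r => /(_ isT) o0; move/dp : e; rewrite edist_le => e.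
    by rewrite mulr_ge0 ?subr_ge0// ltW.
  - by move/d0/edist_eqP : e => ->; rewrite subrr mulr0.
  - rewrite mulN1r oppr_gt0 => /(_ isT) o0; move/dm : e; rewrite edist_le => e.
    by rewrite mulr_le0 ?subr_le0// ltW.
have Ep : \sum_b energy G omega (fun i => p i b 0) = 0.
  apply: big1 => a _; apply: energy_lap0 => // i.
  have := lap_affine eqp 0 (fun a' => (a' == a)%:R) i.
  apply: etrans; apply: eq_bigr => j _; congr (_ * (_ - _)).
    by rewrite add0r (bigD1 a)//= eqxx mul1r big1 ?addr0// => ? /negPf ->; rewrite mul0r.
  by rewrite add0r (bigD1 a)//= eqxx mul1r big1 ?addr0// => ? /negPf ->; rewrite mul0r.
have Et : \sum_i \sum_(j | G i j) t i j = - \sum_b energy G omega (fun i => q i b 0).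
  rewrite -[RHS]add0r -[X in X - _]Ep !sum_energy -sumrB; apply: eq_bigr => i _.
  by rewrite -sumrB; apply: eq_bigr => j _; rewrite -mulrBr.
have t0 : 0 <= \sum_i \sum_(j | G i j) t i j.
  by apply: sumr_ge0 => i _; apply: sumr_ge0 => j; apply: tge0.
have q0 : \sum_b energy G omega (fun i => q i b 0) = 0.
  apply/eqP; rewrite eq_le sumr_ge0 ?andbT => [|b _]; last exact: E0g.
  by rewrite -oppr_ge0 -Et.
split=> [i j Gij|b]; last first.
  move/eqP: q0; rewrite psumr_eq0 => [|b' _]; last exact: E0g.
  by move/allP/(_ b (mem_index_enum _))/eqP.
have tij0 : t i j = 0.
  move/eqP: Et; rewrite q0 oppr0 psumr_eq0; last first.
    by move=> i' _; apply: sumr_ge0 => j'; apply: tge0.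
  move/allP/(_ i (mem_index_enum _)); rewrite /= psumr_eq0; last by move=> j'; apply: tge0.
  by move/allP/(_ j (mem_index_enum _)); rewrite Gij => /eqP.
have [_ str] := strict Gij.
have [[e s]|[e s]|[e s]] := sign_cases Gij; last first.
- move/eqP: tij0; rewrite mulf_eq0 subr_eq0 => /orP[/eqP o0|/eqP ->//].
  by move: str; rewrite s o0 mulr0 ltxx => /(_ isT).
- by have [_ [d0 _]] := dom i j; move/d0/edist_eqP : e => ->.
- move/eqP: tij0; rewrite mulf_eq0 subr_eq0 => /orP[/eqP o0|/eqP ->//].
  by move: str; rewrite s o0 mulr0 ltxx => /(_ isT).
Qed.

(* For an affine image [q] of [p], write [s i j] for the difference of the inner
   products of [q] and [p].  As edge lengths agree, [lap (fun i => s i i)] is a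
   multiple of the equilibrium condition, so [s i i] is affine in [p i]; since
   closed neighbourhoods span, [s] is then constant. *)
Lemma stress_universally_rigid :
  (forall i, affinely_spans (closed_nbhd G i) p) -> universally_rigid G sigma p.
Proof.
move=> spn d' _ q dom i0 j0; apply/edist_eqP.
have psp : affinely_spans predT p by apply: affinely_spansW (spn i0).
have [edges Eq] := dominated_edge_eq psp dom.
have E0g f : 0 <= energy G omega f by move: f; apply/psd_laplacianP.
have ker := proj1 (laplacian_rankP Gsym omega_sym eqp psp) omega_rank.
(* Every coordinate of [q] has zero energy, so it lies in the kernel and is affine in [p]. *)
have /choice[c /choice[A qE]] : forall b : 'I_d', exists c (A : 'I_d -> R),
    forall i, q i b 0 = c + \sum_a A a * p i a 0.
  by move=> b; apply/ker/(energy_eq0_lap Gsym omega_sym E0g).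
pose al i b := \sum_a A b a * p i a 0.
pose s i j := \sum_b al i b * al j b - \sum_a p i a 0 * p j a 0.
pose w i a := \sum_b al i b * A b a - p i a 0.
have sw i j : s i j = \sum_a w i a * p j a 0.
  rewrite /s /w; under [RHS]eq_bigr do rewrite mulrBl mulr_suml.
  rewrite sumrB exchange_big/=; congr (_ - _); apply: eq_bigr => b _.
  by rewrite mulr_sumr; apply: eq_bigr => a _; rewrite mulrA.
have sC i j : s i j = s j i.
  by rewrite /s; congr (_ - _); apply: eq_bigr => ? _; rewrite mulrC.
have dE i j : sqdist (q i) (q j) - sqdist (p i) (p j) = s i i + s j j - s i j *+ 2.
  have -> : sqdist (q i) (q j) = \sum_b (al i b - al j b) ^+ 2.
    by apply: eq_bigr => b _; rewrite !qE opprD addrACA subrr add0r.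
  by rewrite [sqdist _ _]sum_sqrB sum_sqrB /s; ring.
have sedge i j : closed_nbhd G i j -> s i i + s j j - s i j *+ 2 = 0.
  by case/predU1P => [->|/edges e]; [ring | rewrite -dE e subrr].
have [i|c0 [b cb]] := ker (fun i => s i i).
  transitivity (\sum_a w i a * (\sum_(j | G i j) omega i j *: (p i - p j)) a 0 *+ 2); last first.
    by rewrite eqp big1// => a _; rewrite mxE mulr0 mul0rn.
  under [RHS]eq_bigr => a _ do rewrite summxE mulr_sumr -sumrMnl.
  rewrite exchange_big; apply: eq_bigr => j Gij /=.
  have -> : s i i - s j j = (s i i - s i j) *+ 2.
    have : closed_nbhd G i j by rewrite /closed_nbhd Gij orbT.
    by move/sedge => e; rewrite -[RHS]subr0 -e; ring.
  rewrite !sw -sumrB -sumrMnl mulr_sumr; apply: eq_bigr => a _.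
  by rewrite !mxE; ring.
(* For fixed [i], substituting [cb] into [sedge] gives an affine form in [p j] that vanishes on the
   closed neighbourhood of [i]. *)
have cst i : c0 + s i i = 0 /\ forall a, b a = w i a *+ 2.
  have [|] := affine_form_eq0 (c := c0 + s i i) (b := fun a => b a - w i a *+ 2) (spn i).
    move=> j /sedge; rewrite (sw i j) (cb j) => e.
    have -> : \sum_a (b a - w i a *+ 2) * p j a 0 =
        \sum_a b a * p j a 0 - (\sum_a w i a * p j a 0) *+ 2.
      by rewrite -sumrMnl -sumrB; apply: eq_bigr => a _; rewrite mulrBl mulrnAl.
    by rewrite -[RHS]e; ring.
  by move=> -> ba; split=> // a; apply/eqP; rewrite -subr_eq0 ba.
have s2 i j : s i j *+ 2 = - (c0 *+ 2).
  have [_ bw] := cst i; have [cj _] := cst j.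
  transitivity (\sum_a b a * p j a 0).
    by rewrite sw -sumrMnl; apply: eq_bigr => a _; rewrite bw mulrnAl.
  transitivity (s j j - c0); first by rewrite cb; ring.
  by rewrite -[RHS](addr0 _) -cj; ring.
apply/esym/eqP; rewrite -subr_eq0 dE s2.
by have [ci _] := cst i0; have [cj _] := cst j0; apply/eqP; lra.
Qed.

End Sufficiency.

(** * Genericity over a subfield *)

Section GenField.
Variables (R : fieldType) (S : R -> Prop).

Lemma gen_field1 : gen_field S 1. Proof. by move=> P. Qed.

Lemma gen_fieldB a b : gen_field S a -> gen_field S b -> gen_field S (a - b).
Proof. by move=> Ka Kb P S1 S2 S3 S4 S5; exact: S3 (Ka P S1 S2 S3 S4 S5) (Kb P S1 S2 S3 S4 S5). Qed.

Lemma gen_fieldM a b : gen_field S a -> gen_field S b -> gen_field S (a * b).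
Proof. by move=> Ka Kb P S1 S2 S3 S4 S5; exact: S4 (Ka P S1 S2 S3 S4 S5) (Kb P S1 S2 S3 S4 S5). Qed.

Lemma gen_field_sub a : S a -> gen_field S a.
Proof. by move=> Sa P SP *; apply: SP. Qed.

End GenField.

Section Generic.
Import -(notations) mpoly.
Variables (R : realType) (n : nat) (K : R -> Prop).
Hypotheses (K1 : K 1) (KB : forall a b, K a -> K b -> K (a - b))
  (KM : forall a b, K a -> K b -> K (a * b)).

Lemma polyfun0_mpoly (f : ('I_n -> R) -> (nat -> R) -> R) : polyfun K 0 f ->
  exists P : mpoly n R, (forall m, K (mcoeff m P)) /\
    forall x y, meval x P = f x y.
Proof.
have K0 := subring_0 K1 KB; have KD := subring_D K1 KB.
have Kb (b : bool) : K b%:R by case: b.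
elim=> {f} [c Kc|i|//|f g _ [P [KP EP]] _ [Q [KQ EQ]]|f g _ [P [KP EP]] _ [Q [KQ EQ]]].
- exists (mpolyC n c); split=> [m|x y]; last exact: mevalC.
  by rewrite mcoeffC; apply: KM.
- exists (mpolyX R (mnm1 i)); split=> [m|x y]; last exact: mevalXU.
  by rewrite mcoeffX.
- exists (P + Q); split=> [m|x y]; first by rewrite mcoeffD; apply: KD.
  by rewrite mevalD (EP x y) (EQ x y).
- exists (P * Q); split=> [m|x y]; last by rewrite mevalM (EP x y) (EQ x y).
  by rewrite mcoeffM; elim/big_ind: _ => // *; apply: KM.
Qed.

End Generic.

Section GenericConfiguration.
Variables (R : realType) (V : finType) (d : nat) (K : R -> Prop)
  (S : (V -> 'cV[R]_d) -> Prop).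
Hypotheses (K1 : K 1) (KB : forall a b, K a -> K b -> K (a - b))
  (KM : forall a b, K a -> K b -> K (a * b)).

Lemma generic_in_liftable (p : V -> 'cV[R]_d) : generic_in K S p ->
  forall N y, liftable K (fun x => exists2 q, S q & x = coords q) N (coords p) y.
Proof.
move=> [Sp gp]; apply: generic_liftable => // f Pf y f0 x [q Sq ->].
have [P [KP EP]] := polyfun0_mpoly K1 KB KM Pf.
apply: contrapT => fq; apply: gp; exists P; split=> //.
rewrite (EP _ y); split=> //; exists q; split=> //.
by rewrite (EP _ y); apply/eqP.
Qed.

End GenericConfiguration.

(** * Stresses and flexes *)

Section Misc.
Variable R : realType.

Lemma sum_enum_val (T : finType) (F : T -> R) :
  \sum_(k < #|T|) F (enum_val k) = \sum_t F t.
Proof. by rewrite [RHS](reindex _ (onW_bij _ (@enum_val_bij T))). Qed.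

(** If [c < 0], then at [t = min(tau, - c / D)] the quadratic term is at most [- t c], half the size
    of the negative linear term. *)
Lemma first_order_ge0 (c m tau : R) : 0 < tau ->
  (forall t, 0 <= t <= tau -> 0 <= t * c *+ 2 + t ^+ 2 * m) -> 0 <= c.
Proof.
move=> tau0 H; rewrite leNgt; apply/negP => c0.
pose D := `|m| + 1; have D0 : 0 < D by rewrite ltr_pwDr.
pose t := Num.min tau (- c / D).
have t0 : 0 < t by rewrite lt_min tau0 divr_gt0// oppr_gt0.
have tD : t * D <= - c by rewrite -ler_pdivlMr// ge_min lexx orbT.
have := H t; rewrite (ltW t0) ge_min lexx => /(_ isT).
have : t * m <= t * D by rewrite ler_pM2l// (le_trans (ler_norm m))// lerDl.
by move: tD; move: (D) => ?; nra.
Qed.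

Lemma polyfun_limit_eq0 (J : finType) (S : (J -> R) -> Prop) (l : J -> R) f :
  polyfun (fun _ : R => True) 0 (fun x _ => f x) ->
  (forall e, 0 < e -> exists2 b, S b & forall j, `|b j - l j| < e) ->
  (forall b, S b -> f b = 0) -> f l = 0.
Proof.
move=> Pf lS f0; apply/eqP/negPn/negP => fl.
have fl0 : 0 < `|f l| by rewrite normr_gt0.
have [h h0 H] := polyfun_continuous l (fun _ => 0) Pf fl0.
have [b /f0 fb bl] := lS h h0.
have : `|f b - f l| < `|f l| by apply: (H b (fun _ => 0) bl).
by rewrite fb sub0r normrN ltxx.
Qed.

Lemma gram_form (V W : finType) (u : V -> W -> R) (f : V -> R) :
  \sum_i \sum_j f i * f j * (\sum_k u i k * u j k) =
  \sum_k (\sum_i f i * u i k) ^+ 2.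
Proof.
transitivity (\sum_k \sum_i \sum_j f i * u i k * (f j * u j k)).
  rewrite [RHS]exchange_big; apply: eq_bigr => i _ /=.
  rewrite [RHS]exchange_big; apply: eq_bigr => j _ /=.
  by rewrite mulr_sumr; apply: eq_bigr => k _; ring.
apply: eq_bigr => k _; rewrite expr2 mulr_suml; apply: eq_bigr => i _.
by rewrite mulr_sumr.
Qed.

End Misc.

Definition inner (R : realType) d (x y : 'cV[R]_d) : R := \sum_a x a 0 * y a 0.

Section Alternative.
Variables (R : realType) (V : finType) (G : rel V) (sigma : V -> V -> int).
Hypothesis tG : tensegrity G sigma.
Variables (d : nat) (p : V -> 'cV[R]_d).

Local Notation n := #|V|.
Local Notation cable_or_strut i j := (G i j && (sigma i j != 0)).

Definition edge_change (W : finType) (u : V -> W -> R) (r : V -> V -> R) i j : R :=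
  \sum_k (u i k - u j k) ^+ 2 + (sigma i j)%:~R * r i j ^+ 2.

(** The base configuration [q] is an argument because lifting moves it away from [p], to which
    [balanced] stays tied. *)
Definition flex_of (W : finType) (q : V -> 'cV[R]_d) (u : V -> W -> R) r v :=
  forall i j, G i j -> inner (q i - q j) (v i - v j) *+ 2 + edge_change u r i j = 0.

Definition balanced (W : finType) (u : V -> W -> R) (r : V -> V -> R) :=
  [/\ forall k, \sum_i u i k = 0, forall k a, \sum_i p i a 0 * u i k = 0 &
      forall i j, ~~ cable_or_strut i j -> r i j = 0].

(** Trace of the Gram matrix plus total squared slack: linear in these, and fixing it to one makes
    the feasible set compact. *)
Definition mass (W : finType) (u : V -> W -> R) (r : V -> V -> R) : R :=
  \sum_i \sum_k u i k ^+ 2 + \sum_i \sum_j r i j ^+ 2.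

Lemma mass_ge0 (W : finType) (u : V -> W -> R) r : 0 <= mass u r.
Proof. by apply: addr_ge0; do 2!(apply: sumr_ge0 => ? _); apply: sqr_ge0. Qed.

Let all_const := fun _ : R => True.
Let U (b : V * 'I_n + V * V -> R) i k := b (inl (i, k)).
Let Rr (b : V * 'I_n + V * V -> R) i j := b (inr (i, j)).
Let feasible b := balanced (U b) (Rr b) /\ mass (U b) (Rr b) = 1.

Let pfD := @polyfun_add R all_const (V * 'I_n + V * V)%type 0.
Let pfM := @polyfun_mul R all_const (V * 'I_n + V * V)%type 0.
Let pfC c := @polyfun_cst R all_const (V * 'I_n + V * V)%type 0 c I.
Let pfX := @polyfun_base R all_const (V * 'I_n + V * V)%type 0.
Let pfS := @polyfun_sum R all_const (V * 'I_n + V * V)%type I (fun _ _ _ _ => I) 0.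
Let pfE := @polyfun_exp R all_const (V * 'I_n + V * V)%type I 0.
Let pfB := @polyfun_sub R all_const (V * 'I_n + V * V)%type I (fun _ _ _ _ => I) 0.

Let mass_polyfun : polyfun all_const 0 (fun b _ => mass (U b) (Rr b)).
Proof.
apply: pfD; apply: pfS => i; apply: pfS => k; apply: pfE; exact: pfX.
Qed.

Let feasible_closed : seq_closed feasible.
Proof.
move=> l lS; split; [split|].
- move=> k; apply: (polyfun_limit_eq0 (f := fun b => \sum_i U b i k) _ lS).
    by apply: pfS => i; apply: pfX.
  by move=> b [[]].
- move=> k a; apply: (polyfun_limit_eq0 (f := fun b => \sum_i p i a 0 * U b i k) _ lS).
    by apply: pfS => i; apply: pfM; [apply: pfC | apply: pfX].
  by move=> b [[]].
- move=> i j ij; apply: (polyfun_limit_eq0 (f := fun b => Rr b i j) _ lS).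
    exact: pfX.
  by move=> b [[_ _ H] _]; apply: H.
apply/eqP; rewrite -subr_eq0; apply/eqP.
apply: (polyfun_limit_eq0 (f := fun b => mass (U b) (Rr b) - 1) _ lS).
  by apply: pfB; [apply: mass_polyfun | apply: pfC].
by move=> b [_ ->]; rewrite subrr.
Qed.

Let feasible_bounded b j : feasible b -> `|b j| <= 1.
Proof.
move=> [_ m1]; rewrite -[leRHS]sqrtr1 -sqrtr_sqr ler_sqrt// -m1.
case: j => [[i k]|[i j]]; rewrite /mass.
  rewrite (bigD1 i)//= (bigD1 k)//= -!addrA lerDl !addr_ge0//;
  by do ?(apply: sumr_ge0 => ? _); apply: sqr_ge0.
rewrite addrC (bigD1 i)//= (bigD1 j)//= -!addrA lerDl !addr_ge0//;
by do ?(apply: sumr_ge0 => ? _); apply: sqr_ge0.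
Qed.

Let rowE (g : V -> V -> R) : 'rV[R]_#|{: V * V}| :=
  \row_k (if G (enum_val k).1 (enum_val k).2
          then g (enum_val k).1 (enum_val k).2 else 0).

Let rowE_dot g (w : V -> V -> R) : rowE g *m (\col_k w (enum_val k).1 (enum_val k).2)
  = (\sum_i \sum_(j | G i j) g i j * w i j)%:M.
Proof.
apply/matrixP => a b; rewrite !ord1 !mxE mulr1n.
under eq_bigr => k _ do rewrite !mxE.
rewrite (sum_enum_val (fun e : V * V => (if G e.1 e.2 then g e.1 e.2 else 0) * w e.1 e.2)).
rewrite pair_big_dep/= [RHS]big_mkcond; apply: eq_bigr => -[i j] _ /=.
by case: ifP => //; rewrite mul0r.
Qed.

(** Transposed rigidity matrix: [RigE] sends a velocity to half the derivative of the squared edge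
    lengths. *)
Let Rig : 'M[R]_(#|{: V * 'I_d}|, #|{: V * V}|) := \matrix_m
  rowE (fun i j => (((enum_val m).1 == i)%:R - ((enum_val m).1 == j)%:R) *
    (p i (enum_val m).2 0 - p j (enum_val m).2 0)).

Let RigE (v : V -> 'I_d -> R) :
  (\row_m v (enum_val m).1 (enum_val m).2) *m Rig =
  rowE (fun i j => \sum_a (p i a 0 - p j a 0) * (v i a - v j a)).
Proof.
apply/rowP => k; rewrite !mxE.
under eq_bigr => m _ do rewrite !mxE.
set i := (enum_val k).1; set j := (enum_val k).2.
case: ifP => Gij; last by rewrite big1// => m _; rewrite mulr0.
rewrite (sum_enum_val (fun m : V * 'I_d =>
  v m.1 m.2 * (((m.1 == i)%:R - (m.1 == j)%:R) * (p i m.2 0 - p j m.2 0)))).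
rewrite -(pair_bigA _ (fun l a => v l a * (((l == i)%:R - (l == j)%:R) * (p i a 0 - p j a 0))))/=.
rewrite exchange_big; apply: eq_bigr => a _ /=.
under eq_bigr do rewrite mulrCA mulrBl mulrA mulrC.
have pick l0 : \sum_l (l == l0)%:R * v l a = v l0 a.
  by rewrite (bigD1 l0)//= eqxx mul1r big1 ?addr0// => l /negPf ->; rewrite mul0r.
transitivity ((p i a 0 - p j a 0) *
   (\sum_l (l == i)%:R * v l a - \sum_l (l == j)%:R * v l a)); last by rewrite !pick.
by rewrite -sumrB mulr_sumr; apply: eq_bigr => l _; ring.
Qed.

Let xof b := rowE (edge_change (U b) (Rr b)).
(** [cokermx Rig] kills exactly the row space of [Rig], so [phi] vanishes iff the edge change comes
    from a velocity; it serves in place of the Euclidean distance to that space. *)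
Let proj := cokermx Rig.
Let phi b := (xof b *m proj *m (xof b *m proj)^T) 0 0.

Let phi_continuous b e : 0 < e -> exists2 h, 0 < h &
  forall b', (forall j, `|b' j - b j| < h) -> `|phi b' - phi b| < e.
Proof.
move=> e0; have : polyfun all_const 0 (fun b _ => phi b).
  have phiE b' : phi b' = \sum_k (\sum_j xof b' 0 j * proj j k) ^+ 2.
    by rewrite /phi mxE; apply: eq_bigr => k _; rewrite [(_)^T _ _]mxE mxE expr2.
  apply: (polyfun_ext (fun b _ => phiE b)).
  apply: pfS => k; apply: pfE; apply: pfS => j; apply: pfM; last exact: pfC.
  have xofE b' : xof b' 0 j = if G (enum_val j).1 (enum_val j).2
      then edge_change (U b') (Rr b') (enum_val j).1 (enum_val j).2 else 0.
    by rewrite mxE.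
  apply: (polyfun_ext (fun b _ => xofE b)).
  case: (G _ _); last exact: pfC.
  apply: pfD.
    by apply: pfS => l; apply: pfE; apply: pfB; apply: pfX.
  by apply: pfM; [apply: pfC | apply: pfE; apply: pfX].
move=> Pphi; have [h h0 H] := polyfun_continuous b (fun _ => 0) Pphi e0.
exists h => // b' bb'.
by apply: (H b' (fun _ => 0)).
Qed.

(** Convexity holds for Gram matrices and squared slacks rather than for the pairs themselves: these
    are mixed with weights [1 - t m] and [t], which preserves mass one, and factored again by
    [psd_gram]. *)
Let feasible_segment b (u : V -> 'I_n -> R) r t : feasible b -> balanced u r ->
  0 <= t -> t * mass u r <= 1 -> exists2 b', feasible b' &
  forall i j, edge_change (U b') (Rr b') i j =
    edge_change (U b) (Rr b) i j +
    t * (edge_change u r i j - mass u r * edge_change (U b) (Rr b) i j).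
Proof.
move=> [[b1 b2 b3] bm] [u1 u2 r3] t0; set m := mass u r => tm.
pose Y i j := (1 - t * m) * (\sum_k U b i k * U b j k) + t * \sum_k u i k * u j k.
have tm0 : 0 <= 1 - t * m by rewrite subr_ge0.
have Yform f : \sum_i \sum_j f i * f j * Y i j =
    (1 - t * m) * \sum_k (\sum_i f i * U b i k) ^+ 2 + t * \sum_k (\sum_i f i * u i k) ^+ 2.
  rewrite -!gram_form !mulr_sumr -big_split; apply: eq_bigr => i _ /=.
  by rewrite !mulr_sumr -big_split; apply: eq_bigr => j _ /=; rewrite /Y; ring.
have [||u' u'E] := @psd_gram R V Y.
- by move=> i j; rewrite /Y; congr (_ * _ + _ * _);
    apply: eq_bigr => k _; rewrite mulrC.
- by move=> w; rewrite Yform addr_ge0// mulr_ge0// sumr_ge0// => k _; rewrite sqr_ge0.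
pose r' i j := Num.sqrt ((1 - t * m) * Rr b i j ^+ 2 + t * r i j ^+ 2).
have r'E i j : r' i j ^+ 2 = (1 - t * m) * Rr b i j ^+ 2 + t * r i j ^+ 2.
  by rewrite sqr_sqrtr// addr_ge0// mulr_ge0// sqr_ge0.
(* Orthogonality survives the new factorisation, being the vanishing of the Gram form at [f]. *)
have u'0 f : (forall k, \sum_i f i * U b i k = 0) -> (forall k, \sum_i f i * u i k = 0) ->
    forall k, \sum_i f i * u' i k = 0.
  move=> f1 f2 k; have : \sum_k (\sum_i f i * u' i k) ^+ 2 = 0.
    rewrite -gram_form; under eq_bigr do under eq_bigr do rewrite -u'E.
    rewrite Yform !big1 ?mulr0 ?addr0// => k' _; first by rewrite f2 expr0n.
    by rewrite f1 expr0n.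
  move/eqP; rewrite psumr_eq0 => [|k' _]; last by rewrite sqr_ge0.
  by move/allP/(_ k (mem_index_enum _)); rewrite /= sqrf_eq0 => /eqP.
exists (fun x => match x with inl (i, k) => u' i k | inr (i, j) => r' i j end).
  split; [split|].
  - move=> k; have := u'0 (fun _ => 1) _ _ k; rewrite /U.
    under eq_bigr do rewrite mul1r; apply => k'.
      by under eq_bigr do rewrite mul1r; apply: b1.
    by under eq_bigr do rewrite mul1r; apply: u1.
  - by move=> k a; apply: u'0 => k'; [apply: b2 | apply: u2].
  - move=> i j ij; apply/eqP; rewrite -sqrf_eq0 [Rr _ _ _]/(r' i j) r'E b3// r3//.
    by rewrite expr0n !mulr0 addr0.
  rewrite /mass /U /Rr; under [X in _ + X]eq_bigr do under eq_bigr do rewrite r'E.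
  have -> : \sum_i \sum_k u' i k ^+ 2 = (1 - t * m) * (\sum_i \sum_k U b i k ^+ 2) +
      t * \sum_i \sum_k u i k ^+ 2.
    rewrite !mulr_sumr -big_split; apply: eq_bigr => i _ /=.
    transitivity (Y i i); first by rewrite u'E; apply: eq_bigr => k _; rewrite expr2.
    by rewrite /Y; congr (_ * _ + _ * _); apply: eq_bigr => k _; rewrite expr2.
  have -> : \sum_i \sum_j ((1 - t * m) * Rr b i j ^+ 2 + t * r i j ^+ 2) =
      (1 - t * m) * (\sum_i \sum_j Rr b i j ^+ 2) + t * \sum_i \sum_j r i j ^+ 2.
    rewrite !mulr_sumr -big_split; apply: eq_bigr => i _ /=.
    by rewrite !mulr_sumr -big_split.
  rewrite addrACA -!mulrDr -[X in _ + t * X]/m.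
  by rewrite -[X in (1 - _) * X]/(mass (U b) (Rr b)) bm; ring.
move=> i j; rewrite /edge_change !sum_sqrB -!u'E r'E /Y.
by move: (\sum_k U b i k * _) => *; ring.
Qed.

(** Half the gradient of [phi] in the edge vector: the candidate stress, indexed by ordered pairs
    and symmetrised later. *)
Let omega0 b i j := (proj *m (xof b *m proj)^T) (enum_rank (i, j)) 0.

Let omega0_dot b g : (rowE g *m proj *m (xof b *m proj)^T) 0 0 =
  \sum_i \sum_(j | G i j) g i j * omega0 b i j.
Proof.
have -> : \sum_i \sum_(j | G i j) g i j * omega0 b i j =
    ((\sum_i \sum_(j | G i j) g i j * omega0 b i j)%:M : 'M_1) 0 0.
  by rewrite mxE eqxx mulr1n.
rewrite -rowE_dot -mulmxA; congr ((_ *m _) 0 0).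
by apply/colP => k; rewrite [RHS]mxE /omega0 -surjective_pairing enum_valK.
Qed.

(** Let [z] and [z'] be the residuals of [b] and [(u, r)]. Optimality along the segment gives
    [<z' - m z, z> >= 0], so [<z', z> >= m <z, z> > 0]. *)
Let omega0_pos b (u : V -> 'I_n -> R) r : feasible b ->
  (forall b', feasible b' -> phi b <= phi b') -> phi b != 0 ->
  balanced u r -> mass u r != 0 ->
  0 < \sum_i \sum_(j | G i j) edge_change u r i j * omega0 b i j.
Proof.
move=> fb bmin phib ur m0; rewrite -omega0_dot.
have {m0}m0 : 0 < mass u r by rewrite lt_neqAle eq_sym m0 mass_ge0.
have {phib}phi0 : 0 < phi b by rewrite lt_neqAle eq_sym phib rv_sqr_ge0.
set z := xof b *m proj; set z' := rowE _ *m proj; set m := mass u r in m0.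
pose w := z' - m *: z.
suff : 0 <= (w *m z^T) 0 0.
  have := phi0 : 0 < (z *m z^T) 0 0.
  rewrite mulmxBl -scalemxAl; move: (z' *m z^T) (z *m z^T) => a1 a2 a20.
  by rewrite !mxE subr_ge0; apply: lt_le_trans; apply: mulr_gt0.
apply: (@first_order_ge0 _ _ ((w *m w^T) 0 0) m^-1); first by rewrite invr_gt0.
move=> t /andP[t0 tm]; have tm1 : t * m <= 1 by rewrite -ler_pdivlMr// div1r.
have [b' fb' b'E] := feasible_segment fb ur t0 tm1.
have zt : xof b' *m proj = z + t *: w.
  rewrite /w scalerBr scalerA /z /z'.
  rewrite !scalemxAl -mulmxBl -mulmxDl; congr (_ *m _); apply/rowP => k.
  by rewrite !mxE; case: ifP => _; [rewrite b'E -/m; ring | rewrite !mulr0 subrr addr0].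
have := bmin b' fb'; rewrite /phi zt -/z -subr_ge0; congr (0 <= _).
have wz : (z *m w^T) 0 0 = (w *m z^T) 0 0 by rewrite -[in LHS](trmxK z) -trmx_mul mxE.
rewrite [(z + _)^T]linearD/= [(t *: w)^T]linearZ/= mulmxDl !mulmxDr -!scalemxAr -!scalemxAl.
move: wz; move: (z *m z^T) (z *m w^T) (w *m z^T) (w *m w^T) => a1 a2 a3 a4 wz.
by rewrite !mxE wz; ring.
Qed.

(** Elementary test data suffice: a unit velocity yields equilibrium, a [u] with one nonzero column
    yields positive energy off the affine functions, and a single slack yields the strict sign. *)
Lemma stress_of_positive (w0 : V -> V -> R) : affinely_spans predT p ->
  (forall (v : V -> 'I_d -> R), \sum_i \sum_(j | G i j)
     (\sum_a (p i a 0 - p j a 0) * (v i a - v j a)) * w0 i j = 0) ->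
  (forall (u : V -> 'I_n -> R) r, balanced u r -> mass u r != 0 ->
     0 < \sum_i \sum_(j | G i j) edge_change u r i j * w0 i j) ->
  exists omega : V -> V -> R,
     [/\ stress_on G omega, equilibrium_stress G omega p,
         strictly_proper G sigma omega, psd (laplacian G omega) &
         \rank (laplacian G omega) = (n - d.+1)%N].
Proof.
move=> psp eq0 pos; pose omega i j := w0 i j + w0 j i.
have Gsym : symmetric G by exact: tG.1.2.
have osym : stress_on G omega by move=> i j _; rewrite /omega addrC.
have sym_sum (g : V -> V -> R) : (forall i j, g i j = g j i) ->
    \sum_i \sum_(j | G i j) omega i j * g i j = (\sum_i \sum_(j | G i j) g i j * w0 i j) *+ 2.
  move=> gsym; rewrite mulr2n [X in _ = _ + X](exchange_big_dep predT)//= -big_split.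
  apply: eq_bigr => i _ /=.
  rewrite [X in _ = _ + X](eq_bigl (G i)); last by move=> j; rewrite Gsym.
  rewrite -big_split; apply: eq_bigr => j _ /=.
  by rewrite /omega (gsym j i); ring.
have eqp : equilibrium_stress G omega p.
  move=> l; apply/colP => a; rewrite summxE [RHS]mxE.
  pose v i a' : R := ((i == l) && (a' == a))%:R.
  pose h i j := \sum_a (p i a 0 - p j a 0) * (v i a - v j a).
  have hE i j : h i j = (p i a 0 - p j a 0) * ((i == l)%:R - (j == l)%:R).
    rewrite /h (bigD1 a)//= /v eqxx !andbT big1 ?addr0// => a' /negPf ->.
    by rewrite !andbF subrr mulr0.
  have : \sum_i \sum_(j | G i j) omega i j * h i j = 0.
    by rewrite sym_sum ?eq0 ?mul0rn// => i j; rewrite !hE; ring.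
  have -> : \sum_i \sum_(j | G i j) omega i j * h i j =
     \sum_i \sum_(j | G i j) (omega i j * (p i a 0 - p j a 0) * (i == l)%:R) +
     \sum_i \sum_(j | G i j) (omega j i * (p j a 0 - p i a 0) * (j == l)%:R).
    rewrite -big_split; apply: eq_bigr => i _ /=.
    rewrite -big_split; apply: eq_bigr => j Gij /=.
    by rewrite hE (osym j i) 1?Gsym//; ring.
  rewrite [X in _ + X](exchange_big_dep predT)//=.
  under [X in _ + X]eq_bigr => j _ do under eq_bigl do rewrite Gsym.
  rewrite -mulr2n => /eqP; rewrite mulrn_eq0/= => /eqP.
  rewrite (bigD1 l)//= [X in _ + X]big1 ?addr0 => [|i /negPf il]; last first.
    by apply: big1 => j _; rewrite il mulr0.
  by apply: etrans; apply: eq_bigr => j _; rewrite eqxx mulr1 !mxE.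
have posE f : \sum_i f i = 0 -> (forall a, \sum_i p i a 0 * f i = 0) ->
    (exists i, f i != 0) -> 0 < energy G omega f.
  move=> f1 fp [i0 fi0]; pose k0 := enum_rank i0.
  pose u i k : R := if k == k0 then f i else 0.
  have := pos u (fun _ _ => 0); rewrite /energy => H.
  rewrite (sym_sum (fun i j => (f i - f j) ^+ 2)) => [|i j]; last by rewrite -sqrrN opprB.
  rewrite pmulrn_lgt0//.
  suff -> : \sum_i \sum_(j | G i j) (f i - f j) ^+ 2 * w0 i j =
      \sum_i \sum_(j | G i j) edge_change u (fun _ _ => 0) i j * w0 i j.
    apply: H; first split=> //.
    - by move=> k; rewrite /u; case: eqP => // _; rewrite big1.
    - by move=> k a; rewrite /u; case: eqP => // _; rewrite big1// => i _; rewrite mulr0.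
    apply/eqP => m0; have : f i0 ^+ 2 <= mass u (fun _ _ => 0).
      rewrite /mass (bigD1 i0)//= (bigD1 k0)//= /u eqxx -!addrA lerDl !addr_ge0//;
      by do ?(apply: sumr_ge0 => ? _); apply: sqr_ge0.
    by rewrite m0 le_eqVlt sqrf_eq0 (negPf fi0)/= ltNge sqr_ge0.
  apply: eq_bigr => i _; apply: eq_bigr => j _; congr (_ * _); rewrite /edge_change.
  rewrite expr0n mulr0 addr0 (bigD1 k0)//= /u eqxx big1 ?addr0// => k /negPf ->.
  by rewrite subrr expr0n.
have posS i j : cable_or_strut i j -> 0 < (sigma i j)%:~R * w0 i j.
  move=> ij; pose r i' j' : R := ((i' == i) && (j' == j))%:R.
  have := pos (fun _ _ => 0) r; rewrite (bigD1 i)//= (bigD1 j)//=; last by case/andP: ij.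
  rewrite !big1 ?addr0 /edge_change; last 2 first.
  - move=> i' i'i; apply: big1 => j' _; rewrite big1; last by move=> k _; rewrite subrr expr0n.
    by rewrite /r (negPf i'i) expr0n mulr0 addr0 mul0r.
  - move=> j' /andP[_ j'j]; rewrite big1; last by move=> k _; rewrite subrr expr0n.
    by rewrite /r (negPf j'j) andbF expr0n mulr0 addr0 mul0r.
  rewrite big1; last by move=> k _; rewrite subrr expr0n.
  rewrite /r !eqxx expr1n mulr1 add0r; apply.
    split=> [k|k a|i' j'].
    - by rewrite big1.
    - by rewrite big1// => ? _; rewrite mulr0.
    - by apply: contraNeq; rewrite pnatr_eq0 eqb0 negbK => /andP[/eqP -> /eqP ->].
  rewrite /mass big1 ?add0r => [|i' _]; last by rewrite big1// => k _; rewrite expr0n.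
  rewrite (bigD1 i)//= (bigD1 j)//= !eqxx expr1n gt_eqF// -addrA ltr_pwDl//.
  by rewrite addr_ge0// ?sumr_ge0// => i' _; rewrite ?sumr_ge0// => *; apply: sqr_ge0.
have energy_gt0 f c b (g := fun i => f i - (c + \sum_a b a * p i a 0)) :
    \sum_i g i = 0 -> (forall a, \sum_i p i a 0 * g i = 0) ->
    0 <= energy G omega f /\ (energy G omega f = 0 -> forall i, g i = 0).
  move=> g1 gp; have -> : energy G omega f = energy G omega g.
    have lg i : lap G omega (fun i => c + \sum_a b a * p i a 0) i = 0.
      exact: lap_affine.
    rewrite -(energy_lap0D Gsym osym g lg); congr energy.
    by apply/funext => i; rewrite subrK.
  have [gi|/forallNP g0] := pselect (exists i, g i != 0).
    have g0 : 0 < energy G omega g by apply: posE.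
    by split=> [|E]; [exact: ltW | rewrite E ltxx in g0].
  have {}g0 i : g i = 0 by apply/eqP/negPn/negP/g0.
  split=> //; rewrite energy_lap0// => i.
  by apply: big1 => j _; rewrite !g0 subrr mulr0.
exists omega; split=> //.
- move=> i j Gij; have [sE _] := tG.2 i j Gij.
  have [s0|s0] := eqVneq (sigma i j) 0; first by rewrite s0 mul0r.
  suff : 0 < (sigma i j)%:~R * omega i j by move=> o0; split=> //; apply: ltW.
  by rewrite mulrDr addr_gt0// ?posS ?Gij// sE posS// Gsym Gij/= -sE s0.
- apply/psd_laplacianP => f; have [c [b [f1 fp]]] := affine_projection psp f.
  exact: (energy_gt0 f c b f1 fp).1.
apply/(laplacian_rankP Gsym osym eqp psp) => f f0.
have [c [b [f1 fp]]] := affine_projection psp f; exists c, b => i.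
apply/eqP; rewrite -subr_eq0; apply/eqP.
by apply: (energy_gt0 f c b f1 fp).2; apply: energy_lap0.
Qed.

(* Over balanced pairs of mass one, minimise the distance from [edge_change] to
   the row space of the rigidity matrix: the residual is a stress, positive by
   first-order optimality, and a zero residual is a flex. *)
Lemma stress_or_flex : affinely_spans predT p ->
  (exists omega : V -> V -> R,
     [/\ stress_on G omega, equilibrium_stress G omega p,
         strictly_proper G sigma omega, psd (laplacian G omega) &
         \rank (laplacian G omega) = (n - d.+1)%N]) \/
  (exists (u : V -> 'I_n -> R) r v,
     [/\ balanced u r, mass u r = 1 & flex_of p u r v]).
Proof.
move=> psp; have [[b0 fb0]|/forallNP nf] := pselect (exists b, feasible b); last first.
  (* Without feasible pairs, rescaling shows that every balanced pair has mass zero, so positivity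
     is vacuous even for the zero weight. *)
  left; apply: (@stress_of_positive (fun _ _ => 0)) => // [v|u r ur m0].
    by apply: big1 => i _; apply: big1 => j _; rewrite mulr0.
  have m1 : 0 < mass u r by rewrite lt_neqAle eq_sym m0 mass_ge0.
  pose s := (Num.sqrt (mass u r))^-1.
  have s2 : s ^+ 2 = (mass u r)^-1 by rewrite exprVn sqr_sqrtr// ltW.
  exfalso; apply: (nf (fun x => match x with inl (i, k) => s * u i k | inr (i, j) => s * r i j end)).
  have [u1 u2 r3] := ur; split; [split|].
  - by move=> k; rewrite -mulr_sumr u1 mulr0.
  - move=> k a; under eq_bigr do rewrite mulrCA.
    by rewrite -mulr_sumr u2 mulr0.
  - by move=> i j /r3 r0; rewrite /Rr r0 mulr0.
  rewrite /mass /U /Rr; under eq_bigr do under eq_bigr do rewrite exprMn.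
  under [X in _ + X]eq_bigr do under eq_bigr do rewrite exprMn.
  under eq_bigr do rewrite -mulr_sumr.
  under [X in _ + X]eq_bigr do rewrite -mulr_sumr.
  by rewrite -!mulr_sumr -mulrDr s2 mulVf.
have phi_ge0 b : 0 <= phi b by apply: rv_sqr_ge0.
have [b fb bmin] := exists_minimizer (ex_intro _ b0 fb0)
  (fun b j => @feasible_bounded b j) feasible_closed phi_ge0 phi_continuous.
have [phi0|phi0] := eqVneq (phi b) 0; last first.
  left; apply: (@stress_of_positive (omega0 b)) => // [v|u r]; last exact: omega0_pos.
  by rewrite -omega0_dot -RigE -(mulmxA _ Rig) mulmx_coker mulmx0 mul0mx mxE.
right; exists (U b), (Rr b).
have /eqP := rv_sqr_eq0 phi0; rewrite -submxE => /submxP[w wE].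
(* The flex equation has the factor 2 and the opposite sign, hence [- w / 2]. *)
exists (fun i => \col_a (- w 0 (enum_rank (i, a)) / 2)); split; [exact: fb.1|exact: fb.2|].
move=> i j Gij; have := RigE (fun i a => w 0 (enum_rank (i, a))).
have -> : \row_m w 0 (enum_rank ((enum_val m).1, (enum_val m).2)) = w.
  by apply/rowP => m; rewrite mxE -surjective_pairing enum_valK.
rewrite -wE => /rowP/(_ (enum_rank (i, j))); rewrite !mxE enum_rankK/= Gij => ->.
by rewrite -sumrMnl -big_split big1//= => a _; rewrite !mxE; field.
Qed.

End Alternative.

(** * Averaging a flex over the group *)

Section SymmetricFlex.
Variables (R : realType) (gT : finGroupType) (hV : finType) (d : nat).
Variable theta : mx_representation R [set: gT]%G d.
Local Notation V := (gT * hV)%type.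
Variables (G : rel V) (sigma : V -> V -> int) (p : V -> 'cV[R]_d).
Hypotheses (thetaO : point_group theta) (tG : tensegrity G sigma)
  (symG : theta_symmetric theta G sigma p).

Definition act (g : gT) (i : V) : V := ((g * i.1)%g, i.2).

Lemma actK g : cancel (act g) (act g^-1).
Proof. by case=> a h; rewrite /act/= mulKg. Qed.

Lemma actM g h i : act g (act h i) = act (g * h)%g i.
Proof. by rewrite /act/= mulgA. Qed.

Lemma sum_act (M : nmodType) g (F : V -> M) : \sum_i F (act g i) = \sum_i F i.
Proof.
rewrite [RHS](reindex (act g))//; exists (act g^-1) => i _; first exact: actK.
by rewrite -{1}[g]invgK actK.
Qed.

Lemma lift_act (Eh : {set hV * hV * gT}) g i j :
  Defs.lift Eh (act g i) (act g j) = Defs.lift Eh i j.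
Proof. by rewrite /Defs.lift/= !invMg -!mulgA !mulKg. Qed.

(** Membership in a lift depends only on the gain, which left translation preserves; [sigma] is
    prescribed on edges only. *)
Lemma G_sigma_act g i j : G (act g i) (act g j) = G i j /\
  (G i j -> sigma (act g i) (act g j) = sigma i j).
Proof.
have [[E0h E0E] [[Eph EpE] [[Emh EmE] _]]] := symG.
have e0 : E0 G sigma (act g i) (act g j) = E0 G sigma i j.
  by rewrite -!E0E lift_act.
have ep : Eplus G sigma (act g i) (act g j) = Eplus G sigma i j.
  by rewrite -!EpE lift_act.
have em : Eminus G sigma (act g i) (act g j) = Eminus G sigma i j.
  by rewrite -!EmE lift_act.
have GE i' j' : G i' j' = [|| E0 G sigma i' j', Eplus G sigma i' j' | Eminus G sigma i' j'].
  apply/idP/idP => [/(sign_cases tG)[][-> _]|]; rewrite ?orbT//.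
  by case/or3P => /andP[].
split=> [|Gij]; first by rewrite !GE e0 ep em.
have [[e ->]|[e ->]|[e ->]] := sign_cases tG Gij.
- by move: e; rewrite -ep => /andP[_ /eqP].
- by move: e; rewrite -e0 => /andP[_ /eqP].
- by move: e; rewrite -em => /andP[_ /eqP].
Qed.

Lemma theta_tr g : (theta g)^T = theta g^-1%g.
Proof.
have u : theta g \in unitmx by apply: (repr_mx_unit theta); rewrite inE.
have := thetaO g; rewrite /orthogonal_mx => H.
by rewrite repr_mxV ?inE// -[LHS](mulKmx u) H mulmx1.
Qed.

Lemma compatible_act (q : V -> 'cV[R]_d) g i : compatible theta q ->
  theta g *m q i = q (act g i).
Proof. by case: i => a h cq; rewrite cq. Qed.

Lemma C_thetaD (q v : V -> 'cV[R]_d) (e : R) : C_theta theta q -> C_theta theta v ->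
  C_theta theta (fun i => q i + e *: v i).
Proof.
move=> [cq q0] [cv v0]; split=> [g a h|].
  by rewrite mulmxDr -scalemxAr cq cv.
by rewrite big_split/= q0 -scaler_sumr v0 scaler0 addr0.
Qed.

Lemma C_theta_centered (q : V -> 'cV[R]_d) : compatible theta q ->
  C_theta theta (centered q).
Proof.
move=> cq; split=> [g a h|].
  rewrite mulmxBr -scalemxAr cq mulmx_sumr /centered; congr (_ - _ *: _).
  rewrite -[RHS](sum_act g); apply: eq_bigr => i _; exact: compatible_act.
rewrite /centered sumrB sumr_const -scaler_nat scalerA.
(* For empty [V] the inverse in [centered] is that of 0, and the sum is empty. *)
have [n0|n0] := eqVneq (#|{: V}|%:R : R) 0; last by rewrite mulfV// scale1r subrr.
rewrite n0 mul0r scale0r subr0; apply: big1 => i _.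
by move/eqP: n0; rewrite pnatr_eq0 -leqn0 leqNgt; case/negP; apply/card_gt0P; exists i.
Qed.

Lemma inner_tr (M : 'M[R]_d) (x y : 'cV_d) : inner (M *m x) y = inner x (M^T *m y).
Proof.
have innerE (x' y' : 'cV[R]_d) : inner x' y' = (x'^T *m y') 0 0.
  by rewrite mxE; apply: eq_bigr => a _; rewrite mxE.
by rewrite !innerE trmx_mul mulmxA.
Qed.

Lemma inner_sumr (I : finType) (x : 'cV_d) (y : I -> 'cV[R]_d) :
  inner x (\sum_i y i) = \sum_i inner x (y i).
Proof.
rewrite /inner exchange_big; apply: eq_bigr => a _ /=.
by rewrite summxE mulr_sumr.
Qed.

(* [u'] stacks the translates of [u] side by side, so that Gram matrices add. *)
Lemma symmetric_flex (u : V -> 'I_#|{: V}| -> R) r v :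
  balanced G sigma p u r -> mass u r = 1 -> flex_of G sigma p u r v ->
  exists (u' : V -> gT * 'I_#|{: V}| -> R) r' (v' : V -> 'cV[R]_d),
    [/\ C_theta theta v', balanced G sigma p u' r', mass u' r' != 0 &
     flex_of G sigma p u' r' v'].
Proof.
move=> [u1 u2 r3] m1 flex; have [_ [_ [_ cp]]] := symG.
pose v0 i := \sum_g (theta g)^T *m v (act g i).
pose u' i (x : gT * 'I_#|{: V}|) := u (act x.1 i) x.2.
pose r' i j := Num.sqrt (\sum_g r (act g i) (act g j) ^+ 2).
have r'E i j : r' i j ^+ 2 = \sum_g r (act g i) (act g j) ^+ 2.
  by rewrite sqr_sqrtr// sumr_ge0// => g _; rewrite sqr_ge0.
have cv0 : compatible theta v0.
  move=> h a b; rewrite -[(h * a)%g]/(act h (a, b)).1 -[b in RHS]/(act h (a, b)).2.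
  rewrite -surjective_pairing /v0 mulmx_sumr [RHS](reindex_inj (mulIg h^-1%g))/=.
  apply: eq_bigr => g _; rewrite actM mulgKV mulmxA; congr (_ *m _).
  by rewrite !theta_tr invMg invgK repr_mxM ?inE.
(* Centring puts the velocity in [C_theta] and leaves its differences unchanged. *)
exists u', r', (centered v0); split; first exact: C_theta_centered.
- split=> [[g k]|[g k] a|i j ij].
  + by rewrite /u'/= (sum_act g (fun i => u i k)).
  + have pE i : p i a 0 = \sum_b theta g b a * p (act g i) b 0.
      have -> : p i = theta g^-1%g *m p (act g i) by rewrite (compatible_act _ _ cp) actK.
      by rewrite -theta_tr mxE; apply: eq_bigr => b _; rewrite mxE.
    transitivity (\sum_b theta g b a * \sum_i p (act g i) b 0 * u (act g i) k).
      under [RHS]eq_bigr do rewrite mulr_sumr.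
      rewrite [RHS]exchange_big; apply: eq_bigr => i _ /=.
      by rewrite pE mulr_suml; apply: eq_bigr => b _; rewrite mulrA.
    apply: big1 => b _; rewrite (sum_act g (fun i => p i b 0 * u i k)) u2.
    exact: mulr0.
  + apply/eqP; rewrite -sqrf_eq0 r'E big1// => g _; rewrite r3 ?expr0n//.
    have [Ge Se] := G_sigma_act g i j; rewrite Ge.
    by case Gij: (G i j) ij Se => //= ij ->.
(* Gram matrices and squares add without cancellation, so the term of the identity already has mass
   one. *)
- suff : 1 <= mass u' r' by move=> m; rewrite gt_eqF// (lt_le_trans _ m).
  rewrite -m1 /mass; apply: lerD.
    apply: ler_sum => i _; rewrite -(pair_bigA _ (fun g k => u' i (g, k) ^+ 2))/=.
    rewrite (bigD1 1%g)//= /u' /act/= mul1g -surjective_pairing lerDl.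
    by rewrite sumr_ge0// => g _; rewrite sumr_ge0// => k _; rewrite sqr_ge0.
  apply: ler_sum => i _; apply: ler_sum => j _; rewrite r'E.
  rewrite (bigD1 1%g)//= /act !mul1g -!surjective_pairing lerDl.
  by rewrite sumr_ge0// => g _; rewrite sqr_ge0.
move=> i j Gij.
have -> : centered v0 i - centered v0 j = v0 i - v0 j.
  by rewrite /centered opprB addrA subrK.
have -> : inner (p i - p j) (v0 i - v0 j) = \sum_g inner (p (act g i) - p (act g j))
    (v (act g i) - v (act g j)).
  rewrite -sumrB inner_sumr; apply: eq_bigr => g _.
  by rewrite -mulmxBr -inner_tr mulmxBr !(compatible_act _ _ cp).
have -> : edge_change sigma u' r' i j = \sum_g edge_change sigma u r (act g i) (act g j).
  rewrite /edge_change big_split/= r'E mulr_sumr; congr (_ + _).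
    by rewrite -(pair_bigA _ (fun g k => (u' i (g, k) - u' j (g, k)) ^+ 2))/=.
  by apply: eq_bigr => g _; rewrite (G_sigma_act g i j).2.
rewrite -sumrMnl -big_split big1//= => g _.
by rewrite flex// (G_sigma_act g i j).1.
Qed.

End SymmetricFlex.

(** * Lifting and integrating flexes *)

Lemma subring_int (R : rcfType) (K : R -> Prop) (z : int) : K 1 ->
  (forall a b, K a -> K b -> K (a - b)) -> K z%:~R.
Proof.
move=> K1 KB; have Kn m : K m%:R.
  by elim: m => [|m Km]; [exact: subring_0|rewrite mulrS; exact: subring_D].
by case: z => m; [apply: Kn | apply: subring_N; last exact: Kn].
Qed.

Section LiftFlex.
Variables (R : realType) (gT : finGroupType) (hV : finType) (d : nat).
Variable theta : mx_representation R [set: gT]%G d.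
Local Notation V := (gT * hV)%type.
Variables (G : rel V) (sigma : V -> V -> int) (p : V -> 'cV[R]_d).
Variables (k : nat) (deg : 'I_k -> nat)
    (rho : forall r : 'I_k, mx_representation R [set: gT]%G (deg r)).
Hypothesis gen_p : generic_in (Q_theta_Gamma theta rho) (C_theta theta) p.

Variable W : finType.
Local Notation J := (V * W + V * V + V * 'I_d)%type.
Let K := Q_theta_Gamma theta rho.
Let K1 : K 1 := @gen_field1 _ _.
Let KB : forall a b, K a -> K b -> K (a - b) := @gen_fieldB _ _.
Let KM : forall a b, K a -> K b -> K (a * b) := @gen_fieldM _ _.

Let xv (x : 'I_#|{: V * 'I_d}| -> R) i a := x (enum_rank (i, a)).
Let uv (y : nat -> R) i w := y (enum_rank (inl (inl (i, w)) : J)).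
Let rv (y : nat -> R) i j := y (enum_rank (inl (inr (i, j)) : J)).
Let vv (y : nat -> R) i a := y (enum_rank (inr (i, a) : J)).

(** Residuals of the flex equation, of the compatibility of the velocity ([F2]) and of its centring
    ([F3]). Their only constants are signs and entries of [theta], all in [K]. *)
Let F1 x y i j := (\sum_a (xv x i a - xv x j a) * (vv y i a - vv y j a)) +
  (\sum_a (xv x i a - xv x j a) * (vv y i a - vv y j a)) +
  (\sum_w (uv y i w - uv y j w) ^+ 2 + (sigma i j)%:~R * rv y i j ^+ 2).
Let F2 (x : 'I_#|{: V * 'I_d}| -> R) y g i a :=
  \sum_b theta g a b * vv y i b - vv y (act g i) a.
Let F3 (x : 'I_#|{: V * 'I_d}| -> R) y a := \sum_i vv y i a.
Let F x y := \sum_i \sum_(j | G i j) F1 x y i j ^+ 2 +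
  \sum_g \sum_i \sum_a F2 x y g i a ^+ 2 + \sum_a F3 x y a ^+ 2.

Let F_polyfun : polyfun K #|{: J}| F.
Proof.
have px i a : polyfun K #|{: J}| (fun x _ => xv x i a) by apply: polyfun_base.
have py (j : J) : polyfun K #|{: J}|
    (fun (_ : 'I_#|{: V * 'I_d}| -> R) y => y (enum_rank j)).
  by apply: polyfun_var; apply: ltn_ord.
have pB f g (Pf : polyfun K #|{: J}| f) (Pg : polyfun K #|{: J}| g) :
    polyfun K #|{: J}| (fun x y => f x y - g x y).
  exact: polyfun_sub.
apply: polyfun_add; first apply: polyfun_add.
- apply: polyfun_sum => // i; apply: polyfun_sum => // j; apply: polyfun_exp => //.
  have pS : polyfun K #|{: J}|
      (fun x y => \sum_a (xv x i a - xv x j a) * (vv y i a - vv y j a)).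
    by apply: polyfun_sum => // a; apply: polyfun_mul; apply: pB; (apply: px || apply: py).
  apply: polyfun_add; first exact: polyfun_add.
  apply: polyfun_add.
    by apply: polyfun_sum => // w; apply: polyfun_exp => //; apply: pB; apply: py.
  apply: polyfun_mul; last by apply: polyfun_exp => //; apply: py.
  by apply: polyfun_cst; apply: subring_int.
- apply: polyfun_sum => // g; apply: polyfun_sum => // i; apply: polyfun_sum => // a.
  apply: polyfun_exp => //; apply: pB; last exact: py.
  apply: polyfun_sum => // b; apply: polyfun_mul; last exact: py.
  by apply: polyfun_cst; apply: gen_field_sub; left; exists g, a, b.
by apply: polyfun_sum => // a; apply: polyfun_exp => //; apply: polyfun_sum => // i; apply: py.
Qed.

Let vcol y i : 'cV[R]_d := \col_a vv y i a.

Let F_eq0 q y : F (coords q) y = 0 <->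
  flex_of G sigma q (uv y) (rv y) (vcol y) /\ C_theta theta (vcol y).
Proof.
have F1E i j : F1 (coords q) y i j = inner (q i - q j) (vcol y i - vcol y j) *+ 2 +
    edge_change sigma (uv y) (rv y) i j.
  rewrite /F1 /inner mulr2n; congr (_ + _ + _);
  by apply: eq_bigr => a _; rewrite !mxE /xv /coords !enum_rankK.
have F2E g i a : F2 (coords q) y g i a = (theta g *m vcol y i - vcol y (act g i)) a 0.
  by rewrite !mxE; congr (_ - _); apply: eq_bigr => b _; rewrite mxE.
have F3E a : F3 (coords q) y a = (\sum_i vcol y i) a 0.
  by rewrite summxE; apply: eq_bigr => i _; rewrite mxE.
have S1 : 0 <= \sum_i \sum_(j | G i j) F1 (coords q) y i j ^+ 2.
  by apply: sumr_ge0 => i _; apply: sumr_ge0 => j _; apply: sqr_ge0.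
have S2 : 0 <= \sum_g \sum_i \sum_a F2 (coords q) y g i a ^+ 2.
  by do 3!(apply: sumr_ge0 => ? _); apply: sqr_ge0.
have S3 : 0 <= \sum_a F3 (coords q) y a ^+ 2.
  by apply: sumr_ge0 => ? _; apply: sqr_ge0.
split=> [/eqP|[fl [cv v0]]]; last first.
  rewrite /F [X in X + _ + _]big1 => [|i _]; last first.
    by apply: big1 => j Gij; rewrite F1E fl// expr0n.
  rewrite [X in _ + X + _]big1 => [|g _]; last first.
    apply: big1 => i _; apply: big1 => a _.
    by rewrite F2E (compatible_act _ _ cv) subrr mxE expr0n.
  by rewrite big1 ?addr0// => a _; rewrite F3E v0 mxE expr0n.
rewrite /F paddr_eq0 ?addr_ge0// paddr_eq0// => /andP[/andP[/eqP E1 /eqP E2] /eqP E3].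
split; last split.
- move=> i j Gij; rewrite -F1E.
  move/eqP: E1; rewrite psumr_eq0; last by move=> ? _; apply: sumr_ge0 => ? _; apply: sqr_ge0.
  move/allP/(_ i (mem_index_enum _)); rewrite /= psumr_eq0; last by move=> ? _; apply: sqr_ge0.
  by move/allP/(_ j (mem_index_enum _)); rewrite Gij/= sqrf_eq0 => /eqP.
- move=> g b h; apply/eqP; rewrite -subr_eq0; apply/eqP/colP => a.
  rewrite [RHS]mxE -[((g * b)%g, h)]/(act g (b, h)) -F2E.
  move/eqP: E2; rewrite psumr_eq0; last by move=> ? _; do 2!(apply: sumr_ge0 => ? _); apply: sqr_ge0.
  move/allP/(_ g (mem_index_enum _)); rewrite /= psumr_eq0; last by move=> ? _; apply: sumr_ge0 => ? _; apply: sqr_ge0.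
  move/allP/(_ (b, h) (mem_index_enum _)); rewrite /= psumr_eq0; last by move=> ? _; apply: sqr_ge0.
  by move/allP/(_ a (mem_index_enum _)); rewrite /= sqrf_eq0 => /eqP.
apply/colP => a; rewrite -F3E mxE.
move/eqP: E3; rewrite psumr_eq0; last by move=> ? _; apply: sqr_ge0.
by move/allP/(_ a (mem_index_enum _)); rewrite /= sqrf_eq0 => /eqP.
Qed.

(** Symmetry of the velocity belongs to the lifted system. Being balanced does not: for [u'] and
    [r'] only closeness to [u] and [r] is retained. *)
Lemma generic_flex_lift (u : V -> W -> R) r v e :
  flex_of G sigma p u r v -> C_theta theta v -> 0 < e ->
  exists2 h, 0 < h & forall q, C_theta theta q ->
    (forall i a, `|q i a 0 - p i a 0| < h) ->
    exists (u' : V -> W -> R) r' v',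
      [/\ C_theta theta v', flex_of G sigma q u' r' v',
          forall i w, `|u' i w - u i w| < e, forall i j, `|r' i j - r i j| < e &
          forall i a, `|v' i a 0 - v i a 0| < e].
Proof.
move=> fl cv e0.
pose Y (j : J) := match j with
  | inl (inl (i, w)) => u i w | inl (inr (i, j)) => r i j | inr (i, a) => v i a 0 end.
pose y m := nth 0 [seq Y j | j <- enum {: J}] m.
have yE j : y (enum_rank j) = Y j.
  by rewrite /y (nth_map j) ?nth_enum_rank// -cardE ltn_ord.
have yu : uv y = u by apply/funext => i; apply/funext => w; rewrite /uv yE.
have yr : rv y = r by apply/funext => i; apply/funext => j; rewrite /rv yE.
have yvv i a : vv y i a = v i a 0 by rewrite /vv yE.
have yv : vcol y = v by apply/funext => i; apply/colP => a; rewrite mxE yvv.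
have F0 : F (coords p) y = 0 by apply/F_eq0; rewrite yu yr yv.
have [h h0 H] := generic_in_liftable K1 KB KM gen_p F_polyfun F0 e0.
exists h => // q Cq qp.
have [|x'|y' /F_eq0[fl' cv'] yy'] := H (coords q); first by exists q.
  by rewrite /coords; apply: qp.
exists (uv y'), (rv y'), (vcol y'); split=> // [i w|i j|i a].
- by rewrite -yu; apply: yy'; apply: ltn_ord.
- by rewrite -yr; apply: yy'; apply: ltn_ord.
- by rewrite mxE -yvv; apply: yy'; apply: ltn_ord.
Qed.

End LiftFlex.

(** * Integrating a flex against universal rigidity *)

Section FlexIntegration.
Variables (R : realType) (V : finType) (G : rel V) (sigma : V -> V -> int).
Variables (d : nat) (p : V -> 'cV[R]_d) (C : (V -> 'cV[R]_d) -> Prop).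
Hypotheses (Cp : C p)
  (CD : forall q v e, C q -> C v -> C (fun i => q i + e *: v i)).
Variables (W : finType) (u : V -> W -> R) (r : V -> V -> R) (v : V -> 'cV[R]_d).
Hypotheses (bal : balanced G sigma p u r) (mass_neq0 : mass u r != 0).
Hypothesis lift : forall e, 0 < e -> exists2 h, 0 < h & forall q, C q ->
  (forall i a, `|q i a 0 - p i a 0| < h) ->
  exists (u' : V -> W -> R) r' v',
    [/\ C v', flex_of G sigma q u' r' v',
        forall i w, `|u' i w - u i w| < e, forall i j, `|r' i j - r i j| < e &
        forall i a, `|v' i a 0 - v i a 0| < e].

Local Notation cable_or_strut i j := (G i j && (sigma i j != 0)).

(** Linear in [(Y, s)], so a lower bound on its rate integrates along the scheme. *)
Let potential (w : V -> R) (Y s : V -> V -> R) : R :=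
  \sum_i \sum_j w i * w j * Y i j + \sum_i \sum_(j | cable_or_strut i j) s i j.

Let gram (u : V -> W -> R) i j := \sum_k u i k * u j k.
Let sq (r : V -> V -> R) i j := r i j ^+ 2.

(** A nonzero column of [u] is its own weight; if [u] is zero, nonzero mass makes the slacks alone
    positive and [w = 0] works. *)
Let exists_weight : exists w : V -> R, [/\ \sum_i w i = 0,
  forall a, \sum_i p i a 0 * w i = 0 & 0 < potential w (gram u) (sq r)].
Proof.
have [u1 u2 r3] := bal.
have s0 : 0 <= \sum_i \sum_(j | cable_or_strut i j) r i j ^+ 2.
  by apply: sumr_ge0 => i _; apply: sumr_ge0 => j _; apply: sqr_ge0.
have [[[i0 k0] /= u0]|/forallNP nu] := pselect (exists x, u x.1 x.2 != 0).
  exists (fun i => u i k0); split=> //; apply: ltr_wpDr => //.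
  rewrite gram_form (bigD1 k0)//= ltr_pwDl//; last by apply: sumr_ge0 => k _; apply: sqr_ge0.
  rewrite exprn_gt0// (bigD1 i0)//= ltr_pwDl ?sumr_ge0// => [|i _]; rewrite -expr2.
    by rewrite lt_neqAle eq_sym sqrf_eq0 u0 sqr_ge0.
  exact: sqr_ge0.
exists (fun _ => 0); split=> [|a|]; try by rewrite big1// => i _; rewrite mulr0.
have u0 i k : u i k = 0 by apply/eqP/negPn/negP/(nu (i, k)).
rewrite /potential big1 ?add0r => [|i _]; last by apply: big1 => j _; rewrite !mul0r.
rewrite lt_neqAle s0 andbT eq_sym; apply: contra mass_neq0 => /eqP r0.
rewrite /mass big1 ?add0r => [|i _]; last by apply: big1 => k _; rewrite u0 expr0n.
rewrite -[X in _ == X]r0; apply/eqP/eq_bigr => i _; rewrite [RHS]big_mkcond.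
by apply: eq_bigr => j _ /=; case: ifPn => // /r3 ->; rewrite expr0n.
Qed.

Let all_const := fun _ : R => True.

Let potential_near w : 0 < potential w (gram u) (sq r) -> exists2 e, 0 < e &
  forall u' r', (forall i k, `|u' i k - u i k| < e) ->
  (forall i j, `|r' i j - r i j| < e) ->
  potential w (gram u) (sq r) / 2 <= potential w (gram u') (sq r').
Proof.
move=> l0; pose l := potential w (gram u) (sq r).
pose U (b : V * W + V * V -> R) i k := b (inl (i, k)).
pose Rr (b : V * W + V * V -> R) i j := b (inr (i, j)).
have Pl : polyfun all_const 0 (fun b _ => potential w (gram (U b)) (sq (Rr b))).
  apply: polyfun_add; apply: polyfun_sum => // i; apply: polyfun_sum => // j.
    apply: polyfun_mul; first exact: polyfun_cst.
    by apply: polyfun_sum => // k; apply: polyfun_mul; apply: polyfun_base.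
  by apply: polyfun_exp => //; apply: polyfun_base.
pose b0 (x : V * W + V * V) := match x with inl (i, k) => u i k | inr (i, j) => r i j end.
have l20 : 0 < l / 2 by rewrite divr_gt0.
have [e e0 H] := polyfun_continuous b0 (fun _ => 0) Pl l20.
exists e => // u' r' uu' rr'.
pose b (x : V * W + V * V) := match x with inl (i, k) => u' i k | inr (i, j) => r' i j end.
have : `|potential w (gram u') (sq r') - l| < l / 2.
  by apply: (H b (fun _ => 0)) => // -[[i k]|[i j]]; [apply: uu' | apply: rr'].
by rewrite ltr_distl => /andP[]; rewrite -/l; lra.
Qed.

(** Conserved by the exact flow, by the flex equation, and zero at the start; in the scheme it
    measures the discretisation error. *)
Let defect (q : V -> 'cV[R]_d) (Y s : V -> V -> R) i j :=
  sqdist (q i) (q j) + (Y i i + Y j j - Y i j *+ 2) + (sigma i j)%:~R * s i j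
  - sqdist (p i) (p j).

(* Euler's scheme for the flow [f(q)' = - edge_change u' r'] of squared edge
   lengths; [Y] and [s] add up the Gram matrices of [u'] and the squares of [r'].  One step of size [e] costs an error of order [e ^ 2]. *)
Let euler (w : V -> R) (h c B e : R) (n : nat) :
  0 <= e -> 0 <= B -> n%:R * e * B < h ->
  (forall q, C q -> (forall i a, `|q i a 0 - p i a 0| < h) ->
    exists (u' : V -> W -> R) r' v', [/\ C v', flex_of G sigma q u' r' v',
      c <= potential w (gram u') (sq r') &
      [/\ forall i k, `|u' i k| <= B, forall i j, `|r' i j| <= B &
          forall i a, `|v' i a 0| <= B]]) ->
  exists (q : V -> 'cV[R]_d) (Y s : V -> V -> R),
    [/\ [/\ C q, forall i a, `|q i a 0 - p i a 0| <= n%:R * e * B,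
            (forall i j, `|Y i j| <= n%:R * e * (#|W|%:R * B ^+ 2)) &
            forall i j, `|s i j| <= n%:R * e * B ^+ 2],
        [/\ forall i j, Y i j = Y j i,
            forall f : V -> R, 0 <= \sum_i \sum_j f i * f j * Y i j &
            forall i j, 0 <= s i j],
        n%:R * e * c <= potential w Y s &
        forall i j, G i j -> `|defect q Y s i j| <= n%:R * e ^+ 2 * (d%:R * (B + B) ^+ 2)].
Proof.
move=> e0 B0 neB flex; have eB : 0 <= e * B by rewrite mulr_ge0.
elim: n neB => [|n IHn] neB.
  exists p, (fun _ _ => 0), (fun _ _ => 0); split; [split|split| |] => //.
  - by move=> i a; rewrite subrr normr0 !mul0r.
  - by move=> i j; rewrite normr0 !mul0r.
  - by move=> i j; rewrite normr0 !mul0r.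
  - by move=> f; rewrite sumr_ge0// => i _; rewrite sumr_ge0// => j _; rewrite mulr0.
  - rewrite /potential !big1 ?addr0 ?mul0r// => i _; apply: big1 => // j _.
    exact: mulr0.
  - by move=> i j _; rewrite /defect mulr0 !(addr0, subr0, mul0rn) subrr normr0 !mul0r.
have nS (x : R) : n.+1%:R * x = n%:R * x + x by rewrite -natr1 mulrDl mul1r.
have [|q [Y [s [[Cq qp YB sB] [Ysym Ypsd s0] pot def]]]] := IHn.
  by apply: le_lt_trans neB; rewrite -!mulrA nS lerDl.
have qh i a : `|q i a 0 - p i a 0| < h.
  by apply: le_lt_trans (qp i a) (le_lt_trans _ neB); rewrite -!mulrA nS lerDl.
have [u' [r' [v' [Cv' fl' pot' [u'B r'B v'B]]]]] := flex q Cq qh.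
exists (fun i => q i + e *: v' i), (fun i j => Y i j + e * gram u' i j),
  (fun i j => s i j + e * sq r' i j).
split; [split|split| |].
- exact: CD.
- move=> i a; rewrite !mxE addrAC -!mulrA nS mulrA.
  apply: le_trans (ler_normD _ _) (lerD (qp i a) _).
  by rewrite normrM ger0_norm// ler_wpM2l.
- move=> i j; rewrite -!mulrA nS; apply: le_trans (ler_normD _ _) (lerD _ _).
    by rewrite mulrA.
  rewrite normrM ger0_norm// ler_wpM2l//; apply: le_trans (ler_norm_sum _ _ _) _.
  rewrite mulr_natl -sumr_const; apply: ler_sum => k _.
  by rewrite normrM expr2 ler_pM.
- move=> i j; rewrite -!mulrA nS; apply: le_trans (ler_normD _ _) (lerD _ _).
    by rewrite mulrA.
  by rewrite normrM ger0_norm// ler_wpM2l// normrX lerXn2r ?nnegrE.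
- by move=> i j; rewrite Ysym; congr (_ + _ * _); apply: eq_bigr => k _; rewrite mulrC.
- move=> f; have -> : \sum_i \sum_j f i * f j * (Y i j + e * gram u' i j) =
      \sum_i \sum_j f i * f j * Y i j + e * \sum_k (\sum_i f i * u' i k) ^+ 2.
    rewrite -gram_form mulr_sumr -big_split; apply: eq_bigr => i _ /=.
    rewrite mulr_sumr -big_split; apply: eq_bigr => j _ /=.
    by rewrite mulrDr (mulrCA _ e).
  by rewrite addr_ge0// mulr_ge0// sumr_ge0// => k _; rewrite sqr_ge0.
- by move=> i j; rewrite addr_ge0// mulr_ge0// sqr_ge0.
- have -> : potential w (fun i j => Y i j + e * gram u' i j)
      (fun i j => s i j + e * sq r' i j) =
      potential w Y s + e * potential w (gram u') (sq r').
    rewrite /potential mulrDr addrACA; congr (_ + _).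
      rewrite mulr_sumr -big_split; apply: eq_bigr => i _ /=.
      rewrite mulr_sumr -big_split; apply: eq_bigr => j _ /=.
      by rewrite mulrDr (mulrCA _ e).
    rewrite mulr_sumr -big_split; apply: eq_bigr => i _ /=.
    by rewrite mulr_sumr -big_split.
  by rewrite -!mulrA nS lerD// ?mulrA// ler_wpM2l.
move=> i j Gij.
(* The flex equation cancels the terms linear in [e]. *)
have -> : defect (fun i => q i + e *: v' i) (fun i j => Y i j + e * gram u' i j)
    (fun i j => s i j + e * sq r' i j) i j =
    defect q Y s i j + e ^+ 2 * sqdist (v' i) (v' j).
  have := fl' i j Gij; rewrite /edge_change sum_sqrB /defect => f0.
  have -> : sqdist (q i + e *: v' i) (q j + e *: v' j) = sqdist (q i) (q j) +
      e * (inner (q i - q j) (v' i - v' j) *+ 2) + e ^+ 2 * sqdist (v' i) (v' j).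
    rewrite /sqdist /inner -sumrMnl !mulr_sumr -!big_split; apply: eq_bigr => a _ /=.
    by rewrite !mxE; ring.
  move: f0; rewrite -/(gram u' i i) -/(gram u' j j) -/(gram u' i j) -/(sq r' i j).
  by move/eqP; rewrite addr_eq0 => /eqP ->; ring.
rewrite -[leRHS]mulrA nS [n%:R * _]mulrA.
apply: le_trans (ler_normD _ _) (lerD (def i j Gij) _).
rewrite normrM (ger0_norm (sqr_ge0 e)) ler_wpM2l ?sqr_ge0//.
rewrite ger0_norm ?sqdist_ge0// mulr_natl -[d in _ *+ d]card_ord -sumr_const.
apply: ler_sum => a _; rewrite -real_normK ?num_real// lerXn2r ?nnegrE ?addr_ge0//.
by apply: le_trans (ler_normB _ _) (lerD _ _).
Qed.

(** [D] bounds the Euler error when this is applied to the defect, and is 0 for inequalities exact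
    along the sequence. *)
Let cluster_ge0 (J : finType) (x : nat -> J -> R) (l : J -> R) f (D : R) :
  polyfun all_const 0 (fun b _ => f b) ->
  (forall e, 0 < e -> forall n0, exists2 n, (n0 <= n)%N &
     forall j, `|x n j - l j| < e) ->
  (forall n, - (D / n.+1%:R) <= f (x n)) -> 0 <= f l.
Proof.
move=> Pf xl fx; rewrite leNgt; apply/negP => fl0.
pose m := - f l / 2; have m0 : 0 < m by rewrite divr_gt0// oppr_gt0.
have [e e0 H] := polyfun_continuous l (fun _ => 0) Pf m0.
have [n nD xn] := xl e e0 (Num.bound (`|D| / m)).
have : `|f (x n) - f l| < m by apply: (H (x n) (fun _ => 0)).
rewrite ltr_distl => /andP[_]; have := fx n.
have : D / n.+1%:R < m.
  apply: le_lt_trans (ler_wpM2r _ (ler_norm D)) _; first by rewrite invr_ge0 ler0n.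
  rewrite ltr_pdivrMr ?ltr0n// mulrC -ltr_pdivrMr//.
  apply: lt_le_trans (archi_boundP _) _; first by rewrite divr_ge0// ltW.
  by rewrite ler_nat (leq_trans nD).
by rewrite /m; move: (D / _) => t; lra.
Qed.

(** As [w] sums to zero, the diagonal terms drop out and squared distances reduce to the Gram
    form. *)
Let sum_weights (w : V -> R) (S : V -> V -> R) : \sum_i w i = 0 ->
  \sum_i \sum_j w i * w j * (S i i + S j j - S i j *+ 2) =
  - (\sum_i \sum_j w i * w j * S i j) *+ 2.
Proof.
move=> w0.
transitivity (\sum_i (\sum_j w j) * (w i * S i i) + \sum_j (\sum_i w i) * (w j * S j j) -
    (\sum_i \sum_j w i * w j * S i j) *+ 2); last first.
  have z (F : V -> R) : \sum_i 0 * F i = 0 by apply: big1 => i _; rewrite mul0r.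
  by rewrite w0 !z !add0r mulNrn.
have -> : \sum_i (\sum_j w j) * (w i * S i i) = \sum_i \sum_j w i * w j * S i i.
  by apply: eq_bigr => i _; rewrite mulr_suml; apply: eq_bigr => j _; ring.
rewrite [X in _ + X - _]exchange_big.
rewrite -sumrMnl -sumrN -!big_split; apply: eq_bigr => i _ /=.
rewrite -sumrMnl -sumrN -!big_split; apply: eq_bigr => j _ /=.
by ring.
Qed.

Local Notation J := (V * 'I_d + V * V + V * V)%type.
Let Qof (b : J -> R) i : 'cV[R]_d := \col_a b (inl (inl (i, a))).
Let Yof (b : J -> R) i j := b (inl (inr (i, j))).
Let sof (b : J -> R) i j := b (inr (i, j)).

Let polyfun_defect i j : polyfun all_const 0 (fun b _ => defect (Qof b) (Yof b) (sof b) i j).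
Proof.
have px (x : J) : polyfun all_const 0 (fun b (_ : nat -> R) => b x) by apply: polyfun_base.
have pB f g (Pf : polyfun all_const 0 f) (Pg : polyfun all_const 0 g) :
    polyfun all_const 0 (fun (x : J -> R) y => f x y - g x y).
  exact: polyfun_sub.
apply: (pB); last exact: polyfun_cst.
apply: polyfun_add; last by apply: polyfun_mul; [exact: polyfun_cst | apply: px].
apply: polyfun_add.
  apply: polyfun_sum => // a; apply: polyfun_exp => //.
  have E (b : J -> R) (_ : nat -> R) : Qof b i a 0 - Qof b j a 0 =
      b (inl (inl (i, a))) - b (inl (inl (j, a))) by rewrite !mxE.
  by apply: (polyfun_ext E); apply: pB; apply: px.
have E (b : J -> R) (_ : nat -> R) : Yof b i i + Yof b j j - Yof b i j *+ 2 =
   Yof b i i + Yof b j j - (Yof b i j + Yof b i j) by rewrite mulr2n.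
by apply: (polyfun_ext E); apply: pB; apply: polyfun_add; apply: px.
Qed.

Lemma flex_not_universally_rigid : ~ universally_rigid G sigma p.
Proof.
move=> UR; have [w [w1 wp pot0]] := exists_weight.
have [e1 e10 near1] := potential_near pot0.
set c := _ / 2 in near1; have c0 : 0 < c by rewrite divr_gt0.
(* Radius [e1] keeps the potential above [c]; radius 1 keeps the lifted data below [B]. *)
have e0 : 0 < Num.min e1 1 by rewrite lt_min e10 ltr01.
have [h h0 Hlift] := lift e0.
pose B := 1 + \sum_i \sum_k `|u i k| + \sum_i \sum_j `|r i j| + \sum_i \sum_a `|v i a 0|.
have le_sum2 (I1 I2 : finType) (F : I1 -> I2 -> R) i j :
    `|F i j| <= \sum_i \sum_j `|F i j|.
  rewrite (bigD1 i)//= (bigD1 j)//= -addrA lerDl addr_ge0// sumr_ge0// => *.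
  by rewrite sumr_ge0.
have S0 (I1 I2 : finType) (F : I1 -> I2 -> R) : 0 <= \sum_i \sum_j `|F i j|.
  by rewrite sumr_ge0// => i _; rewrite sumr_ge0.
have B1 : 1 <= B.
  by rewrite /B -!addrA lerDl !addr_ge0.
have B0 : 0 < B by apply: lt_le_trans B1.
have uB i k : 1 + `|u i k| <= B.
  have := le_sum2 _ _ u i k; have := S0 _ _ r; have := S0 _ _ (fun i a => v i a 0).
  by rewrite /B; lra.
have rB i j : 1 + `|r i j| <= B.
  have := le_sum2 _ _ r i j; have := S0 _ _ u; have := S0 _ _ (fun i a => v i a 0).
  by rewrite /B; lra.
have vB i a : 1 + `|v i a 0| <= B.
  have := le_sum2 _ _ (fun i a => v i a 0) i a; have := S0 _ _ u; have := S0 _ _ r.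
  by rewrite /B; lra.
have near_le (x y b : R) : `|x - y| < 1 -> 1 + `|y| <= b -> `|x| <= b.
  by move=> xy; apply: le_trans; have := ler_normD (x - y) y; rewrite subrK; lra.
have flex q : C q -> (forall i a, `|q i a 0 - p i a 0| < h) ->
    exists (u' : V -> W -> R) r' v', [/\ C v', flex_of G sigma q u' r' v',
      c <= potential w (gram u') (sq r') &
      [/\ forall i k, `|u' i k| <= B, forall i j, `|r' i j| <= B &
          forall i a, `|v' i a 0| <= B]].
  move=> Cq qp; have [u' [r' [v' [Cv' fl' uu' rr' vv']]]] := Hlift q Cq qp.
  exists u', r', v'; split=> //.
    apply: near1 => i j.
      by have := uu' i j; rewrite lt_min => /andP[].
    by have := rr' i j; rewrite lt_min => /andP[].
  split=> i a.
  - by apply: near_le (uB i a); have := uu' i a; rewrite lt_min => /andP[].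
  - by apply: near_le (rB i a); have := rr' i a; rewrite lt_min => /andP[].
  - by apply: near_le (vB i a); have := vv' i a; rewrite lt_min => /andP[].
(* Total time: at speed at most [B], each coordinate moves by at most [h / 2]. *)
pose T := h / 2 / B.
have T0 : 0 < T by rewrite !divr_gt0.
have TB : T * B < h by rewrite divfK ?gt_eqF//; lra.
pose M := \sum_i \sum_a `|p i a 0| + T * B + T * (#|W|%:R * B ^+ 2) + T * B ^+ 2.
have M1 : 0 <= T * B by rewrite mulr_ge0// ltW.
have M2 : 0 <= T * (#|W|%:R * B ^+ 2).
  by rewrite mulr_ge0 ?(ltW T0)// mulr_ge0 ?ler0n ?exprn_ge0 ?(ltW B0).
have M3 : 0 <= T * B ^+ 2 by rewrite mulr_ge0 ?exprn_ge0// ltW.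
have M0 := S0 _ _ (fun i a => p i a 0).
(* The error of [N.+1] steps of length [T / N.+1] adds up to at most [D / N.+1]. *)
pose D := T * T * (d%:R * (B + B) ^+ 2).
have /choice[b bP] : forall N : nat, exists b : J -> R,
    [/\ forall j, `|b j| <= M,
        [/\ forall i j, Yof b i j = Yof b j i,
            forall f : V -> R, 0 <= \sum_i \sum_j f i * f j * Yof b i j &
            forall i j, 0 <= sof b i j],
        T * c <= potential w (Yof b) (sof b) &
        forall i j, G i j -> `|defect (Qof b) (Yof b) (sof b) i j| <= D / N.+1%:R].
  move=> N; have N0 : N.+1%:R != 0 :> R by rewrite pnatr_eq0.
  have NT : N.+1%:R * (T / N.+1%:R) = T by rewrite mulrC divfK.
  have eN0 : 0 <= T / N.+1%:R by rewrite divr_ge0 ?ler0n ?(ltW T0).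
  have TBN : N.+1%:R * (T / N.+1%:R) * B < h by rewrite NT.
  have [q [Y [s [[Cq qp YM sM] Yps pot def]]]] := euler eN0 (ltW B0) TBN flex.
  exists (fun x => match x with inl (inl (i, a)) => q i a 0
    | inl (inr (i, j)) => Y i j | inr (i, j) => s i j end).
  rewrite NT in qp YM sM pot; split=> //.
    move=> [[[i a]|[i j]]|[i j]].
    - have := le_sum2 _ _ (fun i a => p i a 0) i a; have := qp i a.
      by have := ler_normD (q i a 0 - p i a 0) (p i a 0); rewrite subrK /M; lra.
    - by have := YM i j; rewrite /M; lra.
    - by have := sM i j; rewrite /M; lra.
  move=> i j Gij; have -> : D / N.+1%:R =
      N.+1%:R * (T / N.+1%:R) ^+ 2 * (d%:R * (B + B) ^+ 2).
    by rewrite expr2 [N.+1%:R * _]mulrA NT /D; ring.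
  have qE : Qof (fun x => match x with inl (inl (i, a)) => q i a 0
      | inl (inr (i, j)) => Y i j | inr (i, j) => s i j end) = q.
    by apply/funext => l; apply/colP => a; rewrite mxE.
  by rewrite qE; apply: def.
have [l lP] := bounded_cluster (fun n j => let: And4 H _ _ _ := bP n in H j).
have px (x : J) : polyfun all_const 0 (fun b (_ : nat -> R) => b x) by apply: polyfun_base.
have pB f g (Pf : polyfun all_const 0 f) (Pg : polyfun all_const 0 g) :
    polyfun all_const 0 (fun (x : J -> R) y => f x y - g x y).
  exact: polyfun_sub.
have lim_ge0 f : polyfun all_const 0 (fun b _ => f b) -> (forall n, 0 <= f (b n)) -> 0 <= f l.
  move=> Pf fb; apply: (@cluster_ge0 _ b l f 0 Pf lP) => n.
  by rewrite mul0r oppr0.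
have pF (f : V -> V -> R) : polyfun all_const 0
    (fun b (_ : nat -> R) => \sum_i \sum_j f i j * Yof b i j).
  apply: polyfun_sum => // i; apply: polyfun_sum => // j.
  by apply: polyfun_mul; [exact: polyfun_cst | apply: px].
have Ysym i j : Yof l i j = Yof l j i.
  have H i' j' : 0 <= Yof l i' j' - Yof l j' i'.
    apply: (lim_ge0 (fun b => Yof b i' j' - Yof b j' i')); first by apply: pB; apply: px.
    by move=> n; have [_ [Y _ _] _ _] := bP n; rewrite Y subrr.
  by apply/eqP; rewrite eq_le -subr_ge0 H -subr_ge0 H.
have Ypsd f : 0 <= \sum_i \sum_j f i * f j * Yof l i j.
  apply: (lim_ge0 (fun b => \sum_i \sum_j f i * f j * Yof b i j)); first exact: pF.
  by move=> n; have [_ [_ + _] _ _] := bP n.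
have sge0 i j : 0 <= sof l i j.
  by apply: (lim_ge0 (fun b => sof b i j)); [apply: px|move=> n; have [_ [_ _ +] _ _] := bP n].
have pot_l : T * c <= potential w (Yof l) (sof l).
  rewrite -subr_ge0; apply: (lim_ge0 (fun b => potential w (Yof b) (sof b) - T * c)).
    apply: pB; last exact: polyfun_cst.
    apply: polyfun_add; first exact: pF.
    by apply: polyfun_sum => // i; apply: polyfun_sum => // j; apply: px.
  by move=> n; rewrite subr_ge0; have [_ _ + _] := bP n.
have def_l i j : G i j -> defect (Qof l) (Yof l) (sof l) i j = 0.
  move=> Gij; apply/eqP; rewrite eq_le -oppr_ge0; apply/andP; split.
    apply: (@cluster_ge0 _ b l (fun b => - defect (Qof b) (Yof b) (sof b) i j) D _ lP).
      by apply: polyfun_opp => //; apply: polyfun_defect.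
    move=> n; have [_ _ _ /(_ i j Gij)] := bP n.
    by rewrite lerN2 ler_norml => /andP[].
  apply: (@cluster_ge0 _ b l (fun b => defect (Qof b) (Yof b) (sof b) i j) D _ lP).
    exact: polyfun_defect.
  move=> n; have [_ _ _ /(_ i j Gij)] := bP n.
  by rewrite ler_norml => /andP[].
have [Z ZE] := psd_gram Ysym Ypsd.
(* The extra coordinates realise [Y], whose squared distances [defect] adds to those of the
   limit. *)
pose qh i : 'cV[R]_(d + #|V|) := col_mx (Qof l i) (\col_k Z i k).
have qhE i j : sqdist (qh i) (qh j) = sqdist (Qof l i) (Qof l j) +
    (Yof l i i + Yof l j j - Yof l i j *+ 2).
  rewrite [LHS]big_split_ord; congr (_ + _).
    by apply: eq_bigr => a _; rewrite !col_mxEu.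
  by rewrite !ZE -sum_sqrB; apply: eq_bigr => k _; rewrite !col_mxEd !mxE.
have edge i j : G i j -> sqdist (qh i) (qh j) =
    sqdist (p i) (p j) - (sigma i j)%:~R * sof l i j.
  by move=> /def_l; rewrite /defect qhE => /eqP; rewrite subr_eq0 => /eqP <-; ring.
have cong : congruent p qh.
  apply: UR; first exact: leq_addr.
  move=> i j; rewrite !edist_le edist_eqP /Eplus /E0 /Eminus.
  split; last split; case/andP => Gij /eqP sij; rewrite (edge i j Gij) sij.
  - by rewrite mul1r gerBl.
  - by rewrite mul0r subr0.
  - by rewrite mulN1r opprK lerDl.
have dE i j : sqdist (qh i) (qh j) = sqdist (p i) (p j) by apply/edist_eqP/esym/cong.
have s0 i j : cable_or_strut i j -> sof l i j = 0.
  case/andP => Gij sij; have := edge i j Gij; rewrite dE => /eqP.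
  rewrite -subr_eq0 opprB addrC subrK mulf_eq0 intr_eq0 (negPf sij)/=.
  by move=> /eqP.
have sqE k (q : V -> 'cV[R]_k) i j : sqdist (q i) (q j) =
    inner (q i) (q i) + inner (q j) (q j) - inner (q i) (q j) *+ 2.
  exact: sum_sqrB.
have wE k (q : V -> 'cV[R]_k) : \sum_i \sum_j w i * w j * inner (q i) (q j) =
    \sum_a (\sum_i w i * q i a 0) ^+ 2.
  exact: (gram_form (fun i a => q i a 0)).
(* The distance sum of [p] is zero because [w] is orthogonal to its coordinates; congruence carries
   this over to [qh]. *)
have Yw : \sum_i \sum_j w i * w j * Yof l i j <= 0.
  have : \sum_i \sum_j w i * w j * sqdist (p i) (p j) = 0.
    under eq_bigr do under eq_bigr do rewrite sqE.
    rewrite (sum_weights (fun i j => inner (p i) (p j)) w1) wE big1 ?mul0rn ?oppr0 ?mul0rn// => a _.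
    by under eq_bigr do rewrite mulrC; rewrite wp expr0n.
  under eq_bigr do under eq_bigr do rewrite -dE qhE mulrDr.
  under eq_bigr do rewrite big_split.
  rewrite big_split/= (sum_weights (Yof l) w1).
  under eq_bigr do under eq_bigr do rewrite sqE.
  rewrite (sum_weights (fun i j => inner (Qof l i) (Qof l j)) w1) wE.
  have : 0 <= \sum_a (\sum_i w i * Qof l i a 0) ^+ 2 by apply: sumr_ge0 => a _; apply: sqr_ge0.
  by move: (\sum_a _) (\sum_i _) => x y; lra.
have : T * c <= 0.
  apply: le_trans pot_l _; rewrite /potential [X in _ + X]big1 ?addr0// => i _.
  by apply: big1 => j; apply: s0.
by rewrite leNgt mulr_gt0.
Qed.

End FlexIntegration.

Section Centering.
Variables (R : realType) (V : finType) (d : nat) (p : V -> 'cV[R]_d).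

Lemma centeredB i j : centered p i - centered p j = p i - p j.
Proof. by rewrite /centered opprB addrA subrK. Qed.

Lemma sqdist_centered i j : sqdist (centered p i) (centered p j) = sqdist (p i) (p j).
Proof.
apply: eq_bigr => a _; congr (_ ^+ 2).
by have /colP/(_ a) := centeredB i j; rewrite !mxE.
Qed.

Lemma edist_centered i j :
  Defs.edist (centered p i) (centered p j) = Defs.edist (p i) (p j).
Proof. exact/edist_eqP/sqdist_centered. Qed.

Lemma affinely_spans_centered (A : pred V) :
  affinely_spans A p -> affinely_spans A (centered p).
Proof.
move=> Ap x; set c := (#|{: V}|%:R)^-1 *: \sum_j p j.
have [lam [lamA [lam1 lamE]]] := Ap (x + c); exists lam; do 2!split=> //.
under eq_bigr do rewrite /centered scalerBr.
by rewrite sumrB lamE -scaler_suml lam1 scale1r addrK.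
Qed.

End Centering.

Theorem theorem4p1 (R : realType) (gT : finGroupType) (hV : finType) (d : nat)
    (theta : mx_representation R [set: gT]%G d)
    (k : nat) (deg : 'I_k -> nat)
    (rho : forall r : 'I_k, mx_representation R [set: gT]%G (deg r))
    (G : rel (gT * hV)) (sigma : gT * hV -> gT * hV -> int)
    (p : gT * hV -> 'cV[R]_d) :
  point_group theta ->
  irrep_representatives rho ->
  tensegrity G sigma ->
  theta_symmetric theta G sigma p ->
  generic_mod_symmetry theta rho p ->
  (forall i, affinely_spans (closed_nbhd G i) p) ->
  (universally_rigid G sigma p <->
   exists omega : gT * hV -> gT * hV -> R,
     [/\ stress_on G omega, equilibrium_stress G omega p,
         strictly_proper G sigma omega, psd (laplacian G omega) &
         \rank (laplacian G omega) = (#|{: gT * hV}| - d.+1)%N]).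
Proof.
move=> thetaO _ tG symG gen spn; split=> [UR|]; last first.
  by case=> omega [osym eqp strict opsd ork]; exact: stress_universally_rigid opsd ork spn.
have [[i0 _]|/forallNP nV] := pselect (exists i : gT * hV, True); last first.
  have no (i : gT * hV) : False by exact: (nV i I).
  (* With no vertices the truncated subtraction makes the required rank 0. *)
  exists (fun _ _ => 0); split; try by move=> i; case: (no i).
    move=> x; rewrite mxE sumr_ge0// => i _; case: (no (enum_val i)).
  have n0 : #|{: gT * hV}| = 0%N by apply: eq_card0 => i; case: (no i).
  have := rank_leq_row (laplacian G (fun _ _ => 0 : R)).
  by rewrite [X in (_ <= X)%N]n0 leqn0 => /eqP ->; rewrite n0.
(* Genericity concerns the centred configuration, so spanning and rigidity are first transported to
   it. *)
have psp : affinely_spans predT (centered p).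
  by apply: affinely_spans_centered; apply: affinely_spansW (spn i0).
have UR0 : universally_rigid G sigma (centered p).
  move=> d' dd' q dom i j; rewrite edist_centered; apply: UR => // i' j'.
  by have := dom i' j'; rewrite edist_centered.
have [|[u [r [v [bal m1 fl]]]]] := stress_or_flex tG psp.
  move=> [omega [osym eqp strict opsd ork]]; exists omega; split=> // i.
  by rewrite -[RHS](eqp i); apply: eq_bigr => j _; rewrite centeredB.
have [sE0 [sEp [sEm cp]]] := symG.
have symG0 : theta_symmetric theta G sigma (centered p).
  by do 3!split=> //; have [] := C_theta_centered cp.
have [u' [r' [v' [Cv' bal' m' fl']]]] := symmetric_flex thetaO tG symG0 bal m1 fl.
exfalso; apply: (flex_not_universally_rigid (C_theta_centered cp) _ bal' m') UR0.
  by move=> *; apply: C_thetaD.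
by move=> e; apply: (generic_flex_lift gen fl' Cv').
Qed.
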